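(* Let $(X,d,\mu)$ be a metric measure space such that all balls $B_r(x)$, $x\in X$, $r>0$, have finite measure, such that $\inf_{x\in X}\mu(B_r(x))>0$ for some $r>0$, and such that $$\lim_{r\to\infty}\sup_{x\in X}\frac{\mu(B_r(x)\setminus B_{r-1}(x))}{\mu(B_r(x))}=0 .$$ Let $\mathcal{H}\subseteq L^2(X,\mu)$ be a reproducing kernel Hilbert space with reproducing kernel $k(x,y)$ such that $\inf_{x\in X}k(x,x)>0$ and, for some constants $C>0$ and $\sigma>0$, $$|k(x,y)|\le C\,(1+d(x,y))^{-\sigma}\qquad\text{for all }x,y\in X,$$ where $\sigma$ satisfies $$\lim_{r\to\infty}\sup_{x\in X}\int_{X\setminus B_r(x)}(1+d(x,y))^{-2\sigma}\,d\mu(y)=0 .$$ (i) If $\Lambda\subset X$ and there exist $A,B>0$ such that $A\|f\|^2\le\sum_{\lambda\in\Lambda}|f(\lambda)|^2\le B\|f\|^2$ for all $f\in\mathcal{H}$, then $$D^-(\Lambda):=\liminf_{r\to\infty}\inf_{x\in X}\frac{\#(\Lambda\cap B_r(x))}{\mu(B_r(x))}\ \ge\ \liminf_{r\to\infty}\inf_{x\in X}\frac{1}{\mu(B_r(x))}\int_{B_r(x)}k(y,y)\,d\mu(y).$$ (ii) If $\Lambda\subset X$ and for every $a\in\ell^2(\Lambda)$ there exists $f\in\mathcal{H}$ such that $f(\lambda)=a_\lambda$ for all $\lambda\in\Lambda$, then $$D^+(\Lambda):=\limsup_{r\to\infty}\sup_{x\in X}\frac{\#(\Lambda\cap B_r(x))}{\mu(B_r(x))}\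 \le\ \limsup_{r\to\infty}\sup_{x\in X}\frac{1}{\mu(B_r(x))}\int_{B_r(x)}k(y,y)\,d\mu(y).$$
   Context: $B_r(x)=\{y\in X: d(x,y)<r\}$. The metric $d:X\times X\to[0,\infty)$ is assumed to be $\mu\otimes\mu$-measurable (so that balls are $\mu$-measurable); the domain of $\mu$ is not assumed to be the Borel $\sigma$-algebra of $d$. That $\mathcal{H}\subseteq L^2(X,\mu)$ is a reproducing kernel Hilbert space with kernel $k$ means that $\mathcal{H}$ is a Hilbert space of (pointwise defined) complex-valued functions on $X$, carrying the inner product and norm of $L^2(X,\mu)$, such that for all $x\in X$ the function $k_x(y)=k(y,x)=\overline{k(x,y)}$ belongs to $\mathcal{H}$ and $f(x)=\langle f,k_x\rangle=\int_X k(x,y)f(y)\,d\mu(y)$ for all $f\in\mathcal{H}$. $\#$ denotes cardinality. *)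

(* Defs.v *)
From HB Require Import structures.
From mathcomp Require Import all_boot all_order all_algebra.
From mathcomp Require Import all_classical all_reals all_analysis.
From mathcomp Require Import complex.

Set Implicit Arguments.
Unset Strict Implicit.
Unset Printing Implicit Defensive.

Import Order.TTheory GRing.Theory Num.Theory.
Import numFieldNormedType.Exports.

Local Open Scope classical_set_scope.
Local Open Scope ring_scope.
Local Open Scope ereal_scope.

(* The sigma-algebra and the metric are unrelated here: no Borel condition. *)
#[short(type="metricMeasurableType")]
HB.structure Definition MetricMeasurable (R : numDomainType)
  (d : measure_display) := { T of Metric R T & Measurable d T }.

Definition cmod {R : realType} (z : R[i]) : R := ComplexField.Normc.normc z.

Section L2.
Context {d : measure_display} {X : measurableType d} {R : realType}.
Variable mu : {measure set X -> \bar R}.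
Implicit Types f g : X -> R[i].

Definition cmeasurable f :=
  measurable_fun [set: X] (fun x => complex.Re (f x)) /\
  measurable_fun [set: X] (fun x => complex.Im (f x)).

Definition cintegral f : R[i] :=
  Complex (\int[mu]_x complex.Re (f x))%R (\int[mu]_x complex.Im (f x))%R.

Definition L2dot f g : R[i] := cintegral (fun x => f x * (g x)^*%C)%R.

Definition L2norm f : \bar R := 'N[mu]_2[EFin \o (cmod \o f)].

Definition in_L2 f := cmeasurable f /\ L2norm f < +oo.

(* Elements of H are genuine functions, not classes modulo a.e. equality;
   definiteness of the norm on H follows from rkhs_reproducing. *)
Record is_rkhs (H : set (X -> R[i])) (k : X -> X -> R[i]) : Prop := {
  rkhs_L2 : forall f, H f -> in_L2 f ;
  rkhs_zero : H (fun=> 0%R) ;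
  rkhs_linear : forall (a : R[i]) f g, H f -> H g ->
    H (fun x => a * f x + g x)%R ;
  rkhs_complete : forall u : nat -> X -> R[i], (forall n, H (u n)) ->
    (forall e : R, (0 < e)%R -> exists N : nat, forall m n : nat,
      (N <= m)%N -> (N <= n)%N ->
      L2norm (fun x => u m x - u n x)%R < e%:E) ->
    exists2 f, H f & L2norm (fun x => u n x - f x)%R @[n --> \oo] --> 0 ;
  rkhs_hermitian : forall x y, k y x = (k x y)^*%C ;
  rkhs_kernel : forall x, H (fun y => k y x) ;
  rkhs_reproducing : forall f x, H f -> f x = L2dot f (fun y => k y x)
}.

End L2.

Section Sampling.
Context {d : measure_display} {R : realType} {X : metricMeasurableType R d}.
Variable mu : {measure set X -> \bar R}.
Variable H : set (X -> R[i]).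

Definition sqsum (L : set X) (a : X -> R[i]) : \bar R :=
  \esum_(l in L) (cmod (a l) ^+ 2)%:E.

Definition is_sampling (L : set X) : Prop :=
  exists A B : R, [/\ (0 < A)%R, (0 < B)%R &
    forall f, H f -> A%:E * L2norm mu f ^+ 2 <= sqsum L f /\
                     sqsum L f <= B%:E * L2norm mu f ^+ 2].

(* A sequence in l^2(L) is represented by any extension of it to X. *)
Definition is_interpolating (L : set X) : Prop :=
  forall a : X -> R[i], sqsum L a < +oo ->
    exists2 f, H f & forall l, L l -> f l = a l.

Definition lower_density (L : set X) : \bar R :=
  limf_einf (fun r : R => ereal_inf (range (fun x : X =>
    counting (L `&` ball x r) / mu (ball x r)))) +oo%R.

Definition upper_density (L : set X) : \bar R :=
  limf_esup (fun r : R => ereal_sup (range (fun x : X =>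
    counting (L `&` ball x r) / mu (ball x r)))) +oo%R.

(* k y y is real by rkhs_hermitian. *)
Definition ball_average (k : X -> X -> R[i]) (x : X) (r : R) : \bar R :=
  (mu (ball x r))^-1 * \int[mu]_(y in ball x r) (complex.Re (k y y))%:E.

End Sampling.

(* Main.v *)
Require Import Defs.
From HB Require Import structures.
From mathcomp Require Import all_boot all_order all_algebra.
From mathcomp Require Import all_classical all_reals all_analysis.
From mathcomp Require Import measurable_realfun complex ring lra zify.

(** Both inequalities compare, for a large ball, the number of points of [L] in
    the ball with the integral of [k y y] over the ball, which is the trace of
    the compression of the projection onto [H].  The kernel is concentrated
    near the diagonal, uniformly in its centre ([kernel_tail]), so the two
    numbers can differ only through a boundary layer of fixed width, and the
    annular decay makes such a layer negligible against the ball
    ([vol_growth]).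

    Sampling.  The sampling inequality says that on [H] the norm of [L2(nu)],
    where [nu] is the sum of the point masses on [L], is equivalent to the norm
    of [L2(mu)].  By the Riesz representation theorem [H] is then also a
    reproducing kernel Hilbert space for [nu], with a kernel [k']
    ([equivalent_rkhs]); the functions [k' . l] are the canonical dual frame of
    the kernel functions [k . l].  Reproducing [k . y] at [y] in [L2(nu)] gives
    [k y y = \sum_(l in L) k l y * k' y l].  For [y] in the ball the points [l]
    far outside contribute little ([pointwise_estimate]), so this sum may be
    truncated to finitely many [l] and integrated over the ball.  If [l] is deep
    inside the ball, the integral of its term is almost the integral over the
    whole space, which is [k' l l]; and [k' l l <= 1], because [(k' l l)^2] is
    one of the terms of [k' l l = \sum_(m in L) |k' m l|^2].  The other [l] lie
    in an annulus, each contributes a bounded amount, and their number is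
    bounded by the measure of a slightly larger annulus, since each of them
    carries a fixed amount of the mass of its kernel function ([weighted_count]).

    Interpolation.  A gliding hump argument yields a bound [M] such that any
    finite part of [L] has interpolating functions for its Kronecker data of
    norm at most [M] ([uniform_minimality]).  Projecting these onto the span of
    the kernel functions [k . l_j] gives the dual basis [g_j] of that span, and
    [\sum_j g_j y * (k y l_j)^*] is the diagonal of the reproducing kernel of
    the span, hence lies between [0] and [k y y] ([dual_basis]).  Each term has
    integral [g_j l_j = 1] over the whole space and, for [l_j] in the ball,
    almost nothing of it lives outside a slightly larger ball.  So the number of
    points is at most the integral of [k y y] over that larger ball, up to a
    small relative error.

    The integral of [y => k y y] is handled as a lower integral, which is
    monotone without any measurability ([le_lower_integral]). *)

Import Order.TTheory GRing.Theory Num.Theory.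
Import numFieldNormedType.Exports.

Local Open Scope classical_set_scope.
Local Open Scope ring_scope.

(** * The modulus of complex numbers *)

Section Complex.
Context {R : realType}.
Implicit Types z w : R[i].

Lemma cmod_sqr z : cmod z ^+ 2 = complex.Re z ^+ 2 + complex.Im z ^+ 2.
Proof. by case: z => a b; rewrite /cmod /= sqr_sqrtr// addr_ge0// sqr_ge0. Qed.

Lemma cmod_ge0 z : 0 <= cmod z.
Proof. by case: z => a b; rewrite /cmod/= sqrtr_ge0. Qed.

Lemma cmodM z w : cmod (z * w) = cmod z * cmod w.
Proof. exact: ComplexField.Normc.normcM. Qed.

Lemma cmod0 : cmod (0 : R[i]) = 0.
Proof. exact: ComplexField.Normc.normc0. Qed.

Lemma cmodJ z : cmod (z^*)%C = cmod z.
Proof. by case: z => a b; rewrite /cmod/= sqrrN. Qed.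

Lemma ReD z w : complex.Re (z + w) = complex.Re z + complex.Re w.
Proof. by case: z; case: w. Qed.

Lemma ReB z w : complex.Re (z - w) = complex.Re z - complex.Re w.
Proof. by case: z; case: w. Qed.

Lemma ReJ z : complex.Re (z^*)%C = complex.Re z.
Proof. by case: z. Qed.

Lemma Re_sum (I : Type) (s : seq I) (F : I -> R[i]) :
  complex.Re (\sum_(i <- s) F i) = \sum_(i <- s) complex.Re (F i).
Proof. by elim/big_ind2: _ => // x1 x2 y1 y2 <- <-; rewrite ReD. Qed.

Lemma normr_Re_le_cmod z : `|complex.Re z| <= cmod z.
Proof.
rewrite -(ler_pXn2r (ltn0Sn 1)) ?nnegrE ?cmod_ge0// real_normK ?num_real//.
by rewrite cmod_sqr lerDl sqr_ge0.
Qed.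

Lemma Re_le_cmod z : complex.Re z <= cmod z.
Proof. exact: le_trans (ler_norm _) (normr_Re_le_cmod z). Qed.

Lemma cmod_real (a : R) : 0 <= a -> cmod (a%:C)%C = a.
Proof. by move=> a0; rewrite /cmod/= expr0n addr0 sqrtr_sqr ger0_norm. Qed.

Lemma mulcJE z : z * (z^*)%C = ((cmod z ^+ 2)%:C)%C.
Proof. by rewrite cmod_sqr; case: z => a b; simpc; congr Complex; ring. Qed.

Lemma cmod_eq0 z : cmod z = 0 -> z = 0.
Proof. exact: ComplexField.Normc.eq0_normc. Qed.

Lemma cmodN z : cmod (- z) = cmod z.
Proof. by case: z => a b; rewrite /cmod/= !sqrrN. Qed.

Lemma cmodD_sqr_le z w :
  cmod (z + w) ^+ 2 <= 2 * cmod z ^+ 2 + 2 * cmod w ^+ 2.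
Proof.
rewrite !cmod_sqr; case: z w => [a b] [p q] /=.
rewrite -subr_ge0 [leRHS](_ : _ = (a - p) ^+ 2 + (b - q) ^+ 2); last by ring.
by rewrite addr_ge0// sqr_ge0.
Qed.

End Complex.

(** * The inner product of square-integrable functions *)

Section L2theory.
Context {d : measure_display} {X : measurableType d} {R : realType}.
Variable mu : {measure set X -> \bar R}.
Implicit Types (f g h : X -> R[i]) (a : R[i]) (u v : X -> R).

Definition sqint f : \bar R := (\int[mu]_x (cmod (f x) ^+ 2)%:E)%E.
(** As [fine] sends an infinite value to [0], this is the squared norm only for
    functions satisfying [in_L2]. *)
Definition nsq f : R := fine (sqint f).

Lemma sqint_ge0 f : (0 <= sqint f)%E.
Proof. by apply: integral_ge0 => x _; rewrite lee_fin sqr_ge0. Qed.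

Lemma nsq_ge0 f : 0 <= nsq f.
Proof. exact: fine_ge0 (sqint_ge0 f). Qed.

Lemma L2norm_sqr f : (L2norm mu f ^+ 2)%E = sqint f.
Proof.
rewrite /L2norm unlock /Lnorm.body.
rewrite (_ : (\int[mu]_x _)%E = sqint f); last first.
  apply: eq_integral => x _ /=.
  by rewrite ger0_norm ?cmod_ge0// powR_mulrn ?cmod_ge0.
rewrite expe2; have := sqint_ge0 f; case: (sqint f) => [r| |]//.
- rewrite lee_fin => r0; rewrite poweR_EFin -EFinM -expr2.
  rewrite -powR_mulrn ?powR_ge0//.
  by rewrite -powRrM mulVf ?pnatr_eq0// powRr1.
- by move=> _; rewrite poweRyr ?invr_eq0 ?pnatr_eq0// mulyy.
Qed.

Lemma L2norm_ge0 f : (0 <= L2norm mu f)%E. Proof. exact: Lnorm_ge0. Qed.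

Lemma L2norm_lty f : (L2norm mu f < +oo)%E = (sqint f < +oo)%E.
Proof.
rewrite -L2norm_sqr expe2; have := L2norm_ge0 f.
by case: (L2norm mu f) => [r| |]//= _; rewrite ?ltry// mulyy.
Qed.

Lemma in_L2P f : in_L2 mu f <-> cmeasurable f /\ (sqint f < +oo)%E.
Proof. by rewrite /in_L2 L2norm_lty. Qed.

Lemma nsqE f : in_L2 mu f -> sqint f = (nsq f)%:E.
Proof. by move=> /in_L2P[_ fy]; rewrite fineK// ge0_fin_numE// sqint_ge0. Qed.

Lemma L2norm_lt f (e : R) : 0 < e -> in_L2 mu f ->
  (L2norm mu f < e%:E)%E = (nsq f < e ^+ 2).
Proof.
move=> e0 Lf; rewrite -lte_fin -nsqE// -L2norm_sqr expe2 EFinM.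
have := L2norm_ge0 f.
case: (L2norm mu f) => [r| |]//.
by rewrite lee_fin => r0; rewrite -!EFinM !lte_fin -!expr2 ltr_pXn2r// nnegrE// ltW.
Qed.

Lemma cmeasurable_lin a f g : cmeasurable f -> cmeasurable g ->
  cmeasurable (fun x => a * f x + g x).
Proof.
move=> [f1 f2] [g1 g2]; case: a => a b; split.
- rewrite [X in measurable_fun _ X](_ : _ = fun x => a * complex.Re (f x) -
    b * complex.Im (f x) + complex.Re (g x)); last first.
    by apply/funext => x; case: (f x); case: (g x).
  apply: measurable_funD => //; apply: measurable_funB;
    exact: measurable_funM.
- rewrite [X in measurable_fun _ X](_ : _ = fun x => a * complex.Im (f x) +
    b * complex.Re (f x) + complex.Im (g x)); last first.
    by apply/funext => x; case: (f x); case: (g x).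
  apply: measurable_funD => //; apply: measurable_funD;
    exact: measurable_funM.
Qed.

Lemma cmeasurable_cmod_sqr f : cmeasurable f ->
  measurable_fun [set: X] (fun x => cmod (f x) ^+ 2).
Proof.
move=> [f1 f2]; under eq_fun do rewrite cmod_sqr.
by apply: measurable_funD; exact: measurable_funX.
Qed.

Lemma in_L2_dom f (U : X -> R) : cmeasurable f -> 
  mu.-integrable [set: X] (EFin \o U) -> (forall x, cmod (f x) ^+ 2 <= U x) ->
  in_L2 mu f.
Proof.
move=> mf iU fU; apply/in_L2P; split=> //.
move/integrableP: iU => [mU]; apply: le_lt_trans.
apply: ge0_le_integral => //=.
- by move=> x _; rewrite lee_fin sqr_ge0.
- exact/measurable_EFinP/cmeasurable_cmod_sqr.
- exact: (measurableT_comp (@abse_measurable R _) mU).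
- by move=> x _; rewrite lee_fin (le_trans (fU x))// ler_norm.
Qed.

Lemma in_L2_integrable f : in_L2 mu f ->
  mu.-integrable [set: X] (EFin \o (fun x => cmod (f x) ^+ 2)).
Proof.
move=> /in_L2P[mf fy]; apply/integrableP; split.
  exact/measurable_EFinP/cmeasurable_cmod_sqr.
rewrite (le_lt_trans _ fy)// le_eqVlt; apply/orP; left; apply/eqP.
by apply: eq_integral => x _ /=; rewrite ger0_norm// sqr_ge0.
Qed.

Lemma integrable_addR u v : mu.-integrable [set: X] (EFin \o u) ->
  mu.-integrable [set: X] (EFin \o v) ->
  mu.-integrable [set: X] (EFin \o (fun x => u x + v x)).
Proof.
move=> iu iv; have := integrableD measurableT iu iv.
by apply: eq_integrable => // x _; rewrite /= EFinD.
Qed.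

Lemma integrable_scaleR (s : R) u : mu.-integrable [set: X] (EFin \o u) ->
  mu.-integrable [set: X] (EFin \o (fun x => s * u x)).
Proof.
move=> iu; have := integrableZl measurableT s iu.
by apply: eq_integrable => // x _; rewrite /= EFinM.
Qed.

Lemma in_L2_lin a f g : in_L2 mu f -> in_L2 mu g ->
  in_L2 mu (fun x => a * f x + g x).
Proof.
move=> Lf Lg.
apply: (in_L2_dom _ (fun x => (2 * cmod a ^+ 2) * cmod (f x) ^+ 2
     + 2 * cmod (g x) ^+ 2)).
- by apply: cmeasurable_lin; [case: Lf|case: Lg].
- by apply: integrable_addR; apply: integrable_scaleR; exact: in_L2_integrable.
- move=> x; rewrite !cmod_sqr; case: a (f x) (g x) => [a b] [p q] [r s] /=.
  rewrite -subr_ge0 [leRHS](_ : _ = (a * p - b * q - r) ^+ 2 +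
    (a * q + b * p - s) ^+ 2); last by ring.
  by rewrite addr_ge0// sqr_ge0.
Qed.

(** The booleans select real or imaginary parts: these four products are the
    ones that occur in an inner product. *)
Lemma in_L2_integrable_mul f g (p q : bool) : in_L2 mu f -> in_L2 mu g ->
  mu.-integrable [set: X] (EFin \o (fun x =>
    (if p then complex.Re (f x) else complex.Im (f x)) *
    (if q then complex.Re (g x) else complex.Im (g x)))).
Proof.
move=> Lf Lg.
apply: (@le_integrable _ _ _ _ _ _ _
   (EFin \o (fun x => cmod (f x) ^+ 2 + cmod (g x) ^+ 2))) => //.
- apply/measurable_EFinP; apply: measurable_funM.
    by case: p; case: Lf => -[].
  by case: q; case: Lg => -[].
- move=> x _ /=; rewrite lee_fin.
  rewrite [leRHS]ger0_norm ?addr_ge0 ?sqr_ge0// !cmod_sqr.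
  by rewrite ler_norml; case: p; case: q; apply/andP; split; nra.
- by apply: integrable_addR; exact: in_L2_integrable.
Qed.

Lemma L2dotE f g : in_L2 mu f -> in_L2 mu g ->
  L2dot mu f g = Complex
    ((\int[mu]_x (complex.Re (f x) * complex.Re (g x))) +
     (\int[mu]_x (complex.Im (f x) * complex.Im (g x))))
    ((\int[mu]_x (complex.Im (f x) * complex.Re (g x))) -
     (\int[mu]_x (complex.Re (f x) * complex.Im (g x)))).
Proof.
move=> Lf Lg; rewrite /L2dot /cintegral; congr Complex.
- rewrite -RintegralD//.
  + by apply: eq_Rintegral => x _; case: (f x) (g x) => [a b] [p q] /=; ring.
  + exact: (in_L2_integrable_mul f g true true).
  + exact: (in_L2_integrable_mul f g false false).
- rewrite -RintegralB//.
  + by apply: eq_Rintegral => x _; case: (f x) (g x) => [a b] [p q] /=; ring.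
  + exact: (in_L2_integrable_mul f g false true).
  + exact: (in_L2_integrable_mul f g true false).
Qed.

Lemma L2dotC f g : in_L2 mu f -> in_L2 mu g ->
  L2dot mu g f = ((L2dot mu f g)^*)%C.
Proof.
move=> Lf Lg; rewrite !L2dotE//= opprB.
by congr (Complex (_ + _) (_ - _)); apply: eq_Rintegral => x _; rewrite mulrC.
Qed.

Lemma L2dot_linl a f g h : in_L2 mu f -> in_L2 mu g -> in_L2 mu h ->
  L2dot mu (fun x => a * f x + g x) h = a * L2dot mu f h + L2dot mu g h.
Proof.
move=> Lf Lg Lh; rewrite !L2dotE//; last exact: in_L2_lin.
case: a => a b; simpc.
have I p q := in_L2_integrable_mul f h p q Lf Lh.
have J p q := in_L2_integrable_mul g h p q Lg Lh.
have := I true true; have := I true false.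
have := I false true; have := I false false.
have := J true true; have := J true false.
have := J false true; have := J false false.
move=> {I J} /= j1 j2 j3 j4 i1 i2 i3 i4.
have L (s t : R) u v w : mu.-integrable [set: X] (EFin \o u) ->
    mu.-integrable [set: X] (EFin \o v) -> mu.-integrable [set: X] (EFin \o w) ->
    \int[mu]_x (s * u x + t * v x + w x) =
    s * (\int[mu]_x u x) + t * (\int[mu]_x v x) + \int[mu]_x w x.
  move=> iu iv iw.
  have isu := integrable_scaleR s _ iu.
  have itv := integrable_scaleR t _ iv.
  by rewrite RintegralD// ?RintegralD// ?RintegralZl//; exact: integrable_addR.
congr Complex.
- have -> : \int[mu]_x (complex.Re (Complex a b * f x + g x) * complex.Re (h x)) =
      a * (\int[mu]_x (complex.Re (f x) * complex.Re (h x))) +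
      - b * (\int[mu]_x (complex.Im (f x) * complex.Re (h x))) +
      \int[mu]_x (complex.Re (g x) * complex.Re (h x)).
    rewrite -L//; apply: eq_Rintegral => x _.
    by case: (f x) (g x) (h x) => [p q] [r s] [t u] /=; ring.
  have -> : \int[mu]_x (complex.Im (Complex a b * f x + g x) * complex.Im (h x)) =
      a * (\int[mu]_x (complex.Im (f x) * complex.Im (h x))) +
      b * (\int[mu]_x (complex.Re (f x) * complex.Im (h x))) +
      \int[mu]_x (complex.Im (g x) * complex.Im (h x)).
    rewrite -L//; apply: eq_Rintegral => x _.
    by case: (f x) (g x) (h x) => [p q] [r s] [t u] /=; ring.
  by ring.
- have -> : \int[mu]_x (complex.Im (Complex a b * f x + g x) * complex.Re (h x)) =
      a * (\int[mu]_x (complex.Im (f x) * complex.Re (h x))) +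
      b * (\int[mu]_x (complex.Re (f x) * complex.Re (h x))) +
      \int[mu]_x (complex.Im (g x) * complex.Re (h x)).
    rewrite -L//; apply: eq_Rintegral => x _.
    by case: (f x) (g x) (h x) => [p q] [r s] [t u] /=; ring.
  have -> : \int[mu]_x (complex.Re (Complex a b * f x + g x) * complex.Im (h x)) =
      a * (\int[mu]_x (complex.Re (f x) * complex.Im (h x))) +
      - b * (\int[mu]_x (complex.Im (f x) * complex.Im (h x))) +
      \int[mu]_x (complex.Re (g x) * complex.Im (h x)).
    rewrite -L//; apply: eq_Rintegral => x _.
    by case: (f x) (g x) (h x) => [p q] [r s] [t u] /=; ring.
  by ring.
Qed.

Lemma L2dot_self f : in_L2 mu f -> L2dot mu f f = ((nsq f)%:C)%C.
Proof.
move=> Lf; rewrite /L2dot /cintegral /nsq /sqint; congr Complex.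
  by apply: eq_Rintegral => x _; rewrite mulcJE.
under eq_Rintegral do rewrite mulcJE/=.
by rewrite Rintegral_cst// mul0r.
Qed.

End L2theory.

(** A nonnegative quadratic polynomial in [s] has a nonpositive discriminant; the
    form is the one met when expanding the squared norm of [f - s c g] with
    [c] the inner product of [f] and [g]. *)
Lemma cauchy_schwarz_quadratic {R : realType} (c F G : R) : 0 <= c -> 0 <= G ->
  (forall s : R, 0 <= s ^+ 2 * c * G - 2 * s * c + F) -> c <= F * G.
Proof.
move=> c0; rewrite le_eqVlt => /predU1P[<-|G0] H.
  rewrite mulr0 leNgt; apply/negP => cp.
  have := H ((F + 1) / (2 * c)); rewrite mulr0 sub0r.
  have -> : 2 * ((F + 1) / (2 * c)) * c = F + 1 by field; lra.
  lra.
have := H G^-1.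
have -> : G^-1 ^+ 2 * c * G - 2 * G^-1 * c + F = F - c / G by field; lra.
by rewrite subr_ge0 ler_pdivrMr.
Qed.

Section L2geometry.
Context {d : measure_display} {X : measurableType d} {R : realType}.
Variable mu : {measure set X -> \bar R}.
Implicit Types (f g h : X -> R[i]) (a : R[i]) (E : set X).

Lemma in_L2_0 : in_L2 mu (fun=> 0 : R[i]).
Proof.
apply/in_L2P; split; first by split; exact: measurable_cst.
rewrite /sqint; under eq_integral do rewrite cmod0 expr0n/=.
by rewrite integral0.
Qed.

Lemma in_L2Z a f : in_L2 mu f -> in_L2 mu (fun x => a * f x).
Proof.
move=> Lf; have := in_L2_lin mu a f _ Lf in_L2_0.
by under eq_fun do rewrite addr0.
Qed.

Lemma in_L2D f g : in_L2 mu f -> in_L2 mu g -> in_L2 mu (fun x => f x + g x).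
Proof.
move=> Lf Lg; have := in_L2_lin mu 1 f g Lf Lg.
by under eq_fun do rewrite mul1r.
Qed.

Lemma in_L2B f g : in_L2 mu f -> in_L2 mu g -> in_L2 mu (fun x => f x - g x).
Proof.
move=> Lf Lg; have := in_L2_lin mu (-1) g f Lg Lf.
by under eq_fun do rewrite mulN1r addrC.
Qed.

Lemma L2dot0l f : in_L2 mu f -> L2dot mu (fun=> 0) f = 0.
Proof.
move=> Lf; have := L2dot_linl mu (-1) _ _ _ in_L2_0 in_L2_0 Lf.
under [X in L2dot mu X _ = _]eq_fun do rewrite mulr0 addr0.
by rewrite mulN1r addNr.
Qed.

Lemma L2dotZl a f h : in_L2 mu f -> in_L2 mu h ->
  L2dot mu (fun x => a * f x) h = a * L2dot mu f h.
Proof.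
move=> Lf Lh; have := L2dot_linl mu a _ _ _ Lf in_L2_0 Lh.
by under [X in L2dot mu X _ = _]eq_fun do rewrite addr0; rewrite L2dot0l// addr0.
Qed.

Lemma L2dotDl f g h : in_L2 mu f -> in_L2 mu g -> in_L2 mu h ->
  L2dot mu (fun x => f x + g x) h = L2dot mu f h + L2dot mu g h.
Proof.
move=> Lf Lg Lh; have := L2dot_linl mu 1 _ _ _ Lf Lg Lh.
by under [X in L2dot mu X _ = _]eq_fun do rewrite mul1r; rewrite mul1r.
Qed.

Lemma L2dotBl f g h : in_L2 mu f -> in_L2 mu g -> in_L2 mu h ->
  L2dot mu (fun x => f x - g x) h = L2dot mu f h - L2dot mu g h.
Proof.
move=> Lf Lg Lh; have := L2dot_linl mu (-1) _ _ _ Lg Lf Lh.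
under [X in L2dot mu X _ = _]eq_fun do rewrite mulN1r addrC.
by rewrite mulN1r addrC.
Qed.

Lemma nsq_lin a f g : in_L2 mu f -> in_L2 mu g ->
  nsq mu (fun x => a * f x + g x) =
  cmod a ^+ 2 * nsq mu f + 2 * complex.Re (a * L2dot mu f g) + nsq mu g.
Proof.
move=> Lf Lg; have Lfg := in_L2_lin mu a f g Lf Lg.
have := L2dot_self mu _ Lfg.
rewrite L2dot_linl// (L2dotC mu _ _ Lfg Lf) (L2dotC mu _ _ Lfg Lg).
rewrite !L2dot_linl// !L2dot_self// (L2dotC mu _ _ Lf Lg).
move: (L2dot mu f g) => c /(congr1 (@complex.Re R)).
rewrite cmod_sqr => /esym; rewrite [LHS]/= => ->.
by case: a c {Lfg} => [a b] [p q] /=; ring.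
Qed.

Lemma nsqZ a f : in_L2 mu f -> nsq mu (fun x => a * f x) = cmod a ^+ 2 * nsq mu f.
Proof.
move=> Lf; rewrite -[RHS]/(fine (_ * _)%:E) EFinM -nsqE// /sqint -ge0_integralZl//.
- by congr fine; apply: eq_integral => x _; rewrite cmodM exprMn EFinM.
- by case: Lf => mf _; exact/measurable_EFinP/cmeasurable_cmod_sqr.
- by move=> x _; rewrite lee_fin sqr_ge0.
- by rewrite lee_fin sqr_ge0.
Qed.

Lemma nsqD f g : in_L2 mu f -> in_L2 mu g -> nsq mu (fun x => f x + g x) =
  nsq mu f + 2 * complex.Re (L2dot mu f g) + nsq mu g.
Proof.
move=> Lf Lg; have := nsq_lin 1 f g Lf Lg.
under [X in nsq mu X = _]eq_fun do rewrite mul1r.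
by rewrite mul1r cmod_real// expr1n mul1r.
Qed.

Lemma nsqB f g : in_L2 mu f -> in_L2 mu g -> nsq mu (fun x => f x - g x) =
  nsq mu f - 2 * complex.Re (L2dot mu f g) + nsq mu g.
Proof.
move=> Lf Lg; have := nsq_lin (-1) g f Lg Lf.
under [X in nsq mu X = _]eq_fun do rewrite mulN1r addrC.
move=> ->; rewrite (L2dotC mu _ _ Lf Lg) cmod_sqr.
by case: (L2dot mu f g) => p q /=; ring.
Qed.

Lemma cauchy_schwarz f g : in_L2 mu f -> in_L2 mu g ->
  cmod (L2dot mu f g) ^+ 2 <= nsq mu f * nsq mu g.
Proof.
move=> Lf Lg; set c := L2dot mu f g.
apply: cauchy_schwarz_quadratic; rewrite ?sqr_ge0 ?nsq_ge0// => s.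
have := nsq_ge0 mu (fun x => (- (s%:C)%C * c) * g x + f x).
rewrite nsq_lin// (L2dotC mu _ _ Lf Lg) -/c.
rewrite (_ : cmod (- _ * c) ^+ 2 = s ^+ 2 * cmod c ^+ 2); last first.
  by rewrite !cmod_sqr; case: c => p q /=; ring.
rewrite (_ : complex.Re _ = - s * cmod c ^+ 2).
  by move=> H; apply: le_trans H _; rewrite le_eqVlt; apply/orP; left; apply/eqP; ring.
by rewrite cmod_sqr; case: c => p q /=; ring.
Qed.

Definition nrm f := Num.sqrt (nsq mu f).

Lemma nrm_ge0 f : 0 <= nrm f. Proof. exact: sqrtr_ge0. Qed.

Lemma nrm_sqr f : nrm f ^+ 2 = nsq mu f.
Proof. by rewrite sqr_sqrtr// nsq_ge0. Qed.

Lemma cmod_L2dot_le f g : in_L2 mu f -> in_L2 mu g ->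
  cmod (L2dot mu f g) <= nrm f * nrm g.
Proof.
move=> Lf Lg; rewrite -(ler_pXn2r (ltn0Sn 1)) ?nnegrE ?mulr_ge0 ?cmod_ge0 ?nrm_ge0//.
by rewrite exprMn !nrm_sqr cauchy_schwarz.
Qed.

Lemma nrmZ a f : in_L2 mu f -> nrm (fun x => a * f x) = cmod a * nrm f.
Proof.
by move=> Lf; rewrite /nrm nsqZ// sqrtrM ?sqr_ge0// sqrtr_sqr ger0_norm ?cmod_ge0.
Qed.

Lemma nrmD f g : in_L2 mu f -> in_L2 mu g ->
  nrm (fun x => f x + g x) <= nrm f + nrm g.
Proof.
move=> Lf Lg; rewrite -(ler_pXn2r (ltn0Sn 1)) ?nnegrE ?addr_ge0 ?nrm_ge0//.
rewrite nrm_sqr nsqD// sqrrD !nrm_sqr lerD2r lerD2l -[leRHS]mulr_natl ler_pM2l//.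
exact: le_trans (Re_le_cmod _) (cmod_L2dot_le _ _ Lf Lg).
Qed.

Lemma nrm0 : nrm (fun=> 0) = 0.
Proof.
rewrite /nrm (_ : nsq _ _ = 0) ?sqrtr0// /nsq /sqint.
by under eq_integral do rewrite cmod0 expr0n/=; rewrite integral0.
Qed.

Lemma in_L2_sum (I : Type) (s : seq I) (F : I -> X -> R[i]) :
  (forall i, in_L2 mu (F i)) -> in_L2 mu (fun x => \sum_(i <- s) F i x).
Proof.
move=> LF; elim: s => [|i s IH].
  by under eq_fun do rewrite big_nil; exact: in_L2_0.
by under eq_fun do rewrite big_cons; exact: in_L2D.
Qed.

Lemma nrm_sum_le (I : Type) (s : seq I) (F : I -> X -> R[i]) :
  (forall i, in_L2 mu (F i)) ->
  nrm (fun x => \sum_(i <- s) F i x) <= \sum_(i <- s) nrm (F i).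
Proof.
move=> LF; elim: s => [|i s IH].
  by under [X in nrm X]eq_fun do rewrite big_nil; rewrite nrm0 big_nil.
under [X in nrm X]eq_fun do rewrite big_cons; rewrite big_cons.
by rewrite (le_trans (nrmD _ _ _ _))//; [exact: in_L2_sum|rewrite lerD2l].
Qed.

Lemma L2dot_suml (I : Type) (s : seq I) (F : I -> X -> R[i]) h :
  (forall i, in_L2 mu (F i)) -> in_L2 mu h ->
  L2dot mu (fun x => \sum_(i <- s) F i x) h = \sum_(i <- s) L2dot mu (F i) h.
Proof.
move=> LF Lh; elim: s => [|i s IH].
  by under [X in L2dot mu X]eq_fun do rewrite big_nil; rewrite L2dot0l// big_nil.
under [X in L2dot mu X]eq_fun do rewrite big_cons; rewrite big_cons -IH L2dotDl//.
exact: in_L2_sum.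
Qed.

Definition restr E f x := if x \in E then f x else 0.

Lemma sqint_restr E f : measurable E ->
  sqint mu (restr E f) = (\int[mu]_(x in E) (cmod (f x) ^+ 2)%:E)%E.
Proof.
move=> mE; rewrite [RHS]integral_mkcond; apply: eq_integral => x _.
by rewrite /restr patchE; case: ifPn => //; rewrite cmod0 expr0n.
Qed.

Lemma restrC_add E f x : restr E f x + restr (~` E) f x = f x.
Proof.
by rewrite /restr in_setC; case: (x \in E); rewrite /= ?addr0 ?add0r.
Qed.

Lemma cmeasurable_restr E f : measurable E -> cmeasurable f ->
  cmeasurable (restr E f).
Proof.
move=> mE [f1 f2]; rewrite /restr; split.
- rewrite (_ : (fun _ => _) = (fun x => complex.Re (f x)) \_ E).
    by apply/(measurable_restrictT _ mE); exact: measurable_funTS.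
  by apply/funext => x; rewrite patchE/=; case: ifP.
- rewrite (_ : (fun _ => _) = (fun x => complex.Im (f x)) \_ E).
    by apply/(measurable_restrictT _ mE); exact: measurable_funTS.
  by apply/funext => x; rewrite patchE/=; case: ifP.
Qed.

Lemma cmod_restr_le E f x : cmod (restr E f x) ^+ 2 <= cmod (f x) ^+ 2.
Proof. by rewrite /restr; case: ifP => // _; rewrite cmod0 expr0n sqr_ge0. Qed.

Lemma in_L2_restr E f : measurable E -> in_L2 mu f -> in_L2 mu (restr E f).
Proof.
move=> mE Lf; apply: in_L2_dom (in_L2_integrable mu f Lf) _.
  by apply: cmeasurable_restr => //; case: Lf.
exact: cmod_restr_le.
Qed.

Lemma nsq_restr E f : measurable E -> in_L2 mu f ->
  (nsq mu (restr E f))%:E = (\int[mu]_(x in E) (cmod (f x) ^+ 2)%:E)%E.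
Proof. by move=> mE Lf; rewrite -sqint_restr// nsqE//; exact: in_L2_restr. Qed.

Lemma nsq_restr_le E f : measurable E -> in_L2 mu f -> nsq mu (restr E f) <= nsq mu f.
Proof.
move=> mE Lf; rewrite -lee_fin -!nsqE//; last exact: in_L2_restr.
have LE := in_L2_restr E f mE Lf.
apply: ge0_le_integral => //.
- by move=> x _; rewrite lee_fin sqr_ge0.
- by apply/measurable_EFinP/cmeasurable_cmod_sqr; case: LE.
- by apply/measurable_EFinP/cmeasurable_cmod_sqr; case: Lf.
- by move=> x _; rewrite lee_fin cmod_restr_le.
Qed.

Lemma L2dot_restrC E f g : measurable E -> in_L2 mu f -> in_L2 mu g ->
  L2dot mu f g = L2dot mu (restr E f) g + L2dot mu (restr (~` E) f) g.
Proof.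
move=> mE Lf Lg; rewrite -L2dotDl//; try apply: in_L2_restr => //; last first.
  exact: measurableC.
by congr L2dot; apply/funext => x; rewrite restrC_add.
Qed.

Lemma L2dot_restrlr E f g :
  L2dot mu (restr E f) g = L2dot mu f (restr E g).
Proof.
congr cintegral; apply/funext => x; rewrite /restr.
by case: ifP => // _; rewrite conjc0 mul0r mulr0.
Qed.

Lemma Re_L2dot_restr E f g :
  complex.Re (L2dot mu (restr E f) g) =
  \int[mu]_(x in E) complex.Re (f x * (g x)^*)%C.
Proof.
rewrite /L2dot /cintegral/= [RHS]Rintegral_mkcond; apply: eq_Rintegral => x _.
by rewrite /restr patchE; case: ifP => // _; rewrite mul0r.
Qed.

Lemma L2normE f :
  in_L2 mu f -> L2norm mu f = (nrm f)%:E.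
Proof.
move=> Lf; have := L2norm_sqr mu f; rewrite nsqE// -nrm_sqr.
have := L2norm_ge0 mu f; have := L2norm_lty mu f; rewrite nsqE// ltry expe2.
case: (L2norm mu f) => [r| |]// _; rewrite lee_fin -EFinM => r0 [] /eqP.
by rewrite -expr2 eqrXn2 ?nrm_ge0// => /eqP ->.
Qed.

Lemma nsq_restrC E f :
  measurable E -> in_L2 mu f ->
  nsq mu f = nsq mu (restr E f) + nsq mu (restr (~` E) f).
Proof.
move=> mE Lf; apply: EFin_inj; rewrite EFinD !nsq_restr//; last exact: measurableC.
rewrite -nsqE// /sqint -(setUv E) ge0_integral_setU//.
- exact: measurableC.
- by rewrite setUv; case: Lf => mf _; exact/measurable_EFinP/cmeasurable_cmod_sqr.
- by move=> x _; rewrite lee_fin sqr_ge0.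
- by apply/disj_setPS; rewrite setICr.
Qed.

Lemma nsq_restr_sub E F f :
  measurable E -> measurable F -> E `<=` F -> in_L2 mu f ->
  nsq mu (restr E f) <= nsq mu (restr F f).
Proof.
move=> mE mF EF Lf.
have -> : restr E f = restr E (restr F f).
  apply/funext => x; rewrite /restr; case: ifPn => // /set_mem Ex.
  by rewrite mem_set//; exact: EF.
by apply: nsq_restr_le => //; exact: in_L2_restr.
Qed.

Lemma measurable_Re_mulJ f g : cmeasurable f -> cmeasurable g ->
  measurable_fun [set: X] (fun x => complex.Re (f x * (g x)^*)%C).
Proof.
move=> [f1 f2] [g1 g2].
rewrite (_ : (fun _ => _) = (fun x => complex.Re (f x) * complex.Re (g x) +
  complex.Im (f x) * complex.Im (g x))).
  by apply: measurable_funD; exact: measurable_funM.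
by apply/funext => x; case: (f x) (g x) => [a b] [p q] /=; ring.
Qed.

Lemma integrable_Re_mulJ f g : in_L2 mu f -> in_L2 mu g ->
  mu.-integrable [set: X] (EFin \o (fun x => complex.Re (f x * (g x)^*)%C)).
Proof.
move=> Lf Lg; have := integrable_addR mu _ _
  (in_L2_integrable_mul mu f g true true Lf Lg)
  (in_L2_integrable_mul mu f g false false Lf Lg).
apply: eq_integrable => // x _; congr EFin.
by case: (f x) (g x) => [a b] [p q] /=; ring.
Qed.

End L2geometry.

(** * Reproducing kernel Hilbert spaces inside L2 *)

Section Rkhs.
Context {d : measure_display} {X : measurableType d} {R : realType}.
Variables (mu : {measure set X -> \bar R}) (H : set (X -> R[i])).
Variable k : X -> X -> R[i].
Hypothesis Hk : is_rkhs mu H k.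
Implicit Types (f g h : X -> R[i]) (a : R[i]) (x y : X).

Lemma rkhsZ a f : H f -> H (fun x => a * f x).
Proof.
move=> Hf; have := rkhs_linear Hk a Hf (rkhs_zero Hk).
by under eq_fun do rewrite addr0.
Qed.

Lemma rkhsD f g : H f -> H g -> H (fun x => f x + g x).
Proof.
move=> Hf Hg; have := rkhs_linear Hk 1 Hf Hg.
by under eq_fun do rewrite mul1r.
Qed.

Lemma rkhsB f g : H f -> H g -> H (fun x => f x - g x).
Proof.
move=> Hf Hg; have := rkhs_linear Hk (-1) Hg Hf.
by under eq_fun do rewrite mulN1r addrC.
Qed.

Lemma rkhs_sum (I : Type) (s : seq I) (F : I -> X -> R[i]) :
  (forall i, H (F i)) -> H (fun x => \sum_(i <- s) F i x).
Proof.
move=> HF; elim: s => [|i s IH].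
  by under eq_fun do rewrite big_nil; exact: (rkhs_zero Hk).
by under eq_fun do rewrite big_cons; exact: rkhsD.
Qed.

Lemma in_L2_kernel x : in_L2 mu (fun y => k y x).
Proof. exact: (rkhs_L2 Hk (rkhs_kernel Hk x)). Qed.

Lemma nsq_kernel x : nsq mu (fun y => k y x) = complex.Re (k x x).
Proof.
have Hx := rkhs_kernel Hk x.
by rewrite (rkhs_reproducing Hk x Hx) L2dot_self//; exact: (rkhs_L2 Hk Hx).
Qed.

Lemma kernel_diag_ge0 x : 0 <= complex.Re (k x x).
Proof. by rewrite -nsq_kernel nsq_ge0. Qed.

Lemma rkhs_eval_le f x : H f ->
  cmod (f x) ^+ 2 <= nsq mu f * complex.Re (k x x).
Proof.
move=> Hf; rewrite {1}(rkhs_reproducing Hk x Hf) -nsq_kernel.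
by apply: cauchy_schwarz; apply: (rkhs_L2 Hk) => //; exact: (rkhs_kernel Hk x).
Qed.

Lemma rkhs_complete_nsq (u : nat -> X -> R[i]) : (forall n, H (u n)) ->
  (forall e : R, 0 < e -> exists N : nat, forall m n : nat,
    (N <= m)%N -> (N <= n)%N -> nsq mu (fun x => u m x - u n x) < e) ->
  exists2 f, H f & forall e : R, 0 < e -> exists N : nat, forall n : nat,
    (N <= n)%N -> nsq mu (fun x => u n x - f x) < e.
Proof.
move=> Hu cu; have Lu n := rkhs_L2 Hk (Hu n).
have [e e0|f Hf cf] := rkhs_complete Hk Hu.
  have [N HN] := cu (e ^+ 2) (exprn_gt0 2 e0); exists N => m n Nm Nn.
  by rewrite L2norm_lt//; [exact: HN|exact: in_L2B].
exists f => // e e0; have Lf := rkhs_L2 Hk Hf.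
have se0 : 0 < Num.sqrt e by rewrite sqrtr_gt0.
have : \forall n \near \oo, (L2norm mu (fun x => u n x - f x)%R < (Num.sqrt e)%:E)%E.
  have /= := cf [set r | (r < (Num.sqrt e)%:E)%E]; apply.
  by apply: open_nbhs_nbhs; split; [exact: open_ereal_lt_ereal|rewrite /= lte_fin].
move=> [N _ HN]; exists N => n Nn; have := HN n Nn.
by rewrite /= L2norm_lt// ?sqr_sqrtr ?(ltW e0)//; exact: in_L2B.
Qed.

End Rkhs.

Section Equivalent_norm.
Context {d : measure_display} {X : measurableType d} {R : realType}.
Variables (mu nu : {measure set X -> \bar R}) (H : set (X -> R[i])).
Variable k : X -> X -> R[i].
Hypothesis Hk : is_rkhs mu H k.
Hypothesis L2nu : forall f, H f -> in_L2 nu f.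
Variables (A B : R).
Hypothesis A0 : 0 < A.
Hypothesis lowA : forall f, H f -> A * nsq mu f <= nsq nu f.
Hypothesis upB : forall f, H f -> nsq nu f <= B * nsq mu f.
Implicit Types (f g h : X -> R[i]) (a : R[i]) (x y : X).

(** Cauchy sequences for the norm of [nu] are Cauchy for that of [mu] by [lowA],
    and limits for [mu] are limits for [nu] by [upB]. *)
Lemma complete_equivalent (u : nat -> X -> R[i]) : (forall n, H (u n)) ->
  (forall e : R, 0 < e -> exists N : nat, forall m n : nat,
    (N <= m)%N -> (N <= n)%N -> nsq nu (fun x => u m x - u n x) < e) ->
  exists2 f, H f & forall e : R, 0 < e -> exists N : nat, forall n : nat,
    (N <= n)%N -> nsq nu (fun x => u n x - f x) < e.
Proof.
move=> Hu cu; have [e e0|f Hf cf] := rkhs_complete_nsq mu H k Hk u Hu.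
  have [N HN] := cu (A * e) (mulr_gt0 A0 e0); exists N => m n Nm Nn.
  rewrite -(ltr_pM2l A0); apply: le_lt_trans (lowA _ _) (HN _ _ Nm Nn).
  exact: rkhsB Hk _ _ (Hu _) (Hu _).
exists f => // e e0.
have B1 : 0 < `|B| + 1 by rewrite ltr_wpDl.
have [N HN] := cf (e / (`|B| + 1)) (divr_gt0 e0 B1); exists N => n Nn.
have Huf : H (fun x => u n x - f x) by exact: rkhsB Hk _ _ (Hu _) Hf.
apply: le_lt_trans (upB _ Huf) _; have := HN n Nn; rewrite ltr_pdivlMr// mulrC.
apply: le_lt_trans; rewrite ler_wpM2r ?nsq_ge0// (le_trans (ler_norm _))//.
by rewrite lerDl.
Qed.

(** Riesz representation of the evaluation at [y].  The representer minimizes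
    [J f = |f|^2 - 2 Re (f y)]: by the parallelogram identity a minimizing
    sequence is Cauchy, and its limit satisfies the Euler-Lagrange equation.  The
    equation is derived approximately along the sequence and passed to the
    limit, so that the minimality of the limit itself is never discussed. *)
Lemma riesz_eval y : exists2 g, H g & forall f, H f -> f y = L2dot nu f g.
Proof.
pose c := complex.Re (k y y) / A.
have c0 : 0 <= c by rewrite divr_ge0 ?(ltW A0)// (kernel_diag_ge0 mu H k Hk).
have ev f : H f -> cmod (f y) ^+ 2 <= c * nsq nu f.
  move=> Hf; apply: le_trans (rkhs_eval_le mu H k Hk f y Hf) _.
  rewrite mulrC /c mulrAC -mulrA ler_wpM2l ?(kernel_diag_ge0 mu H k Hk)//.
  by rewrite ler_pdivlMr// mulrC lowA.
pose J f := nsq nu f - 2 * complex.Re (f y).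
have J_low f : H f -> - c <= J f.
  move=> Hf; have n0 := nsq_ge0 nu f; have := ev f Hf; rewrite /J.
  have := Re_le_cmod (f y); have := cmod_ge0 (f y).
  move: (cmod (f y)) (nsq nu f) n0 (complex.Re (f y)) => t n n0 r t0 rt tn.
  suff : t <= (n + c) / 2 by lra.
  rewrite -(ler_pXn2r (ltn0Sn 1)) ?nnegrE//; last by lra.
  apply: (le_trans tn); rewrite -subr_ge0 (_ : _ - _ = ((n - c) / 2) ^+ 2) ?sqr_ge0//; by field.
pose S := [set J f | f in H].
have hS : has_inf S.
  split; first by exists (J (fun=> 0)); exists (fun=> 0) => //; exact: (rkhs_zero Hk).
  by exists (- c) => _ [f Hf <-]; exact: J_low.
pose m := inf S.
have Jm f : H f -> m <= J f by move=> Hf; apply: ge_inf hS.2 _ _; exists f.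
have [u Hu] : {u : nat -> X -> R[i] & forall n, H (u n) /\ J (u n) < m + n.+1%:R^-1}.
  apply: (@choice _ _ (fun n f => H f /\ J f < m + n.+1%:R^-1)) => n.
  have e0 : 0 < n.+1%:R^-1 :> R by rewrite invr_gt0.
  have [_ [f Hf <-] Jf] := inf_adherent e0 hS.
  by exists f.
have {Hu} [Hu Ju] : (forall n, H (u n)) /\ (forall n, J (u n) < m + n.+1%:R^-1).
  by split=> n; have [] := Hu n.
have LH f : H f -> in_L2 nu f by exact: L2nu.
have par f g : H f -> H g ->
    nsq nu (fun x => f x - g x) = 2 * J f + 2 * J g - 4 * J (fun x => 2^-1 * (f x + g x)).
  move=> Hf Hg; have Hfg := rkhsD mu H k Hk _ _ Hf Hg.
  rewrite /J nsqZ; last exact: LH.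
  rewrite nsqB; [|exact: LH|exact: LH].
  rewrite nsqD; [|exact: LH|exact: LH].
  rewrite (_ : (2^-1 : R[i]) = (2^-1 : R)%:C%C); last by rewrite rmorphV ?unitfE// rmorph_nat.
  rewrite cmod_real ?invr_ge0//.
  rewrite (_ : complex.Re (_%:C%C * _) = 2^-1 * (complex.Re (f y) + complex.Re (g y))).
    by field.
  by case: (f y) (g y) => [a b] [p q] /=; field.
have inv_small (e : R) : 0 < e -> exists N : nat, forall n, (N <= n)%N -> n.+1%:R^-1 < e.
  move=> e0; have [N HN] := near_infty_natSinv_lt (PosNum e0).
  by move=> HN'; exists N => n Nn; exact: HN'.
have [e e0|g Hg cg] := complete_equivalent u Hu.
  have [N HN] := inv_small (e / 4) (divr_gt0 e0 (ltr0Sn _ 3)).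
  exists N => p q Np Nq; rewrite par//.
  have Hpq : H (fun x => 2^-1 * (u p x + u q x)).
    by apply: rkhsZ Hk _ _ _; exact: rkhsD Hk _ _ (Hu _) (Hu _).
  have := Jm _ Hpq; have := Ju p; have := Ju q.
  have := HN p Np; have := HN q Nq; rewrite !ltr_pdivlMr//.
  move: (q.+1%:R^-1 : R) (p.+1%:R^-1 : R) => a b; lra.
exists g => // h Hh.
have Lh := LH _ Hh; have Lu n := LH _ (Hu n); have Lg := LH _ Hg.
have key n : cmod (L2dot nu h (u n) - h y) ^+ 2 <= (nsq nu h + 1) / n.+1%:R.
  set D := _ - h y; have N0 := nsq_ge0 nu h.
  (* Perturb [u n] by [t * h] with [t] along the conjugate of [D]; the size [s]
     makes the quadratic term at most half of the linear one. *)
  pose s := (nsq nu h + 1)^-1.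
  have s0 : 0 < s by rewrite invr_gt0; lra.
  have sN : s * (nsq nu h + 1) = 1 by rewrite mulVf//; apply/eqP; lra.
  pose t : R[i] := - (s%:C)%C * (D^*)%C.
  have := Jm _ (rkhs_linear Hk t Hh (Hu n)); have := Ju n.
  rewrite /J nsq_lin// => J1 J2.
  have E1 : cmod t ^+ 2 = s ^+ 2 * cmod D ^+ 2.
    by rewrite /t !cmod_sqr; case: (D) => p q /=; ring.
  have E2 : complex.Re (t * L2dot nu h (u n)) - complex.Re (t * h y) = - s * cmod D ^+ 2.
    rewrite -ReB -mulrBr -/D /t cmod_sqr; case: (D) => p q /=; ring.
  rewrite ReD E1 in J2.
  set e := n.+1%:R^-1 in J1 *.
  have {J1 J2}J3 : - e <= s ^+ 2 * cmod D ^+ 2 * nsq nu h - 2 * s * cmod D ^+ 2 by lra.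
  have D0 : 0 <= cmod D ^+ 2 by exact: sqr_ge0.
  have : s * cmod D ^+ 2 <= e.
    have -> : s * cmod D ^+ 2 = 2 * s * cmod D ^+ 2 - s * (s * (nsq nu h + 1)) * cmod D ^+ 2.
      by rewrite sN; ring.
    have : 0 <= s ^+ 2 * cmod D ^+ 2 by rewrite mulr_ge0// sqr_ge0.
    by nra.
  by rewrite /s mulrC ler_pdivrMr ?(mulrC e)//; lra.
suff : cmod (L2dot nu h g - h y) ^+ 2 <= 0.
  rewrite exprn_even_le0//= => /eqP/cmod_eq0/eqP.
  by rewrite subr_eq0 => /eqP.
apply/ler_addgt0Pl => e e0; rewrite addr0.
have N0 := nsq_ge0 nu h.
have N1 : 0 < 4 * (nsq nu h + 1) by lra.
have [N1' HN1] := inv_small _ (divr_gt0 e0 N1).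
have [N2 HN2] := cg _ (divr_gt0 e0 N1).
pose n := maxn N1' N2.
have := HN1 n (leq_maxl _ _); have := HN2 n (leq_maxr _ _).
rewrite !ltr_pdivlMr// => a1 a2.
have -> : L2dot nu h g - h y = (L2dot nu h g - L2dot nu h (u n)) + (L2dot nu h (u n) - h y).
  by rewrite addrA subrK.
apply: le_trans (cmodD_sqr_le _ _) _.
have := key n.
have Lug : in_L2 nu (fun x => u n x - g x) by exact: in_L2B.
have : cmod (L2dot nu h g - L2dot nu h (u n)) ^+ 2 <= nsq nu h * nsq nu (fun x => u n x - g x).
  have := cauchy_schwarz nu h _ Lh Lug.
  rewrite (L2dotC nu _ _ Lug Lh) L2dotBl// (L2dotC nu _ _ Lh Lg) (L2dotC nu _ _ Lh (Lu n)).
  by rewrite -rmorphB conjcK -opprB cmodN.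
have := nsq_ge0 nu (fun x => u n x - g x).
move: (nsq nu (fun x => u n x - g x)) (n.+1%:R^-1 : R) (nsq nu h) N0 a1 a2 => w e' N N0 a1 a2.
move: (cmod _ ^+ 2) (cmod _ ^+ 2) => p q w0 pN qN.
have : N * w <= w * (N + 1) by nra.
lra.
Qed.

(** Being a reproducing kernel space depends on the inner product only through
    completeness and the continuity of evaluations, and both survive the change
    to an equivalent norm. *)
Lemma equivalent_rkhs : exists k', is_rkhs nu H k'.
Proof.
have [G HG] : {G : X -> X -> R[i] & forall y, H (G y) /\ forall f, H f -> f y = L2dot nu f (G y)}.
  apply: (@choice _ _ (fun y g => H g /\ forall f, H f -> f y = L2dot nu f g)) => y.
  by have [g Hg gP] := riesz_eval y; exists g.
exists (fun x y => G y x); split.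
- exact: L2nu.
- exact: (rkhs_zero Hk).
- exact: (rkhs_linear Hk).
- move=> u Hu cu; have Lu n := L2nu _ (Hu n).
  have [e e0|f Hf cf] := complete_equivalent u Hu.
    have se0 : 0 < Num.sqrt e by rewrite sqrtr_gt0.
    have [N HN] := cu _ se0; exists N => m n Nm Nn.
    have := HN m n Nm Nn; rewrite L2norm_lt// ?sqr_sqrtr ?(ltW e0)//.
    exact: in_L2B.
  exists f => //; have Lf := L2nu _ Hf.
  have Luf n : in_L2 nu (fun x => u n x - f x) by exact: in_L2B.
  apply/fine_cvgP; split; first by apply: nearW => n; rewrite L2normE.
  apply/cvgrPdist_lt => e e0; have [N HN] := cf (e ^+ 2) (exprn_gt0 2 e0).
  exists N => // n /= Nn; rewrite L2normE// sub0r normrN ger0_norm ?nrm_ge0//.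
  rewrite -(ltr_pXn2r (ltn0Sn 1)) ?nnegrE ?nrm_ge0 ?(ltW e0)// nrm_sqr.
  exact: HN.
- move=> x y; have [Hx Px] := HG x; have [Hy Py] := HG y.
  rewrite (Px _ Hy) (Py _ Hx) (L2dotC nu _ _ (L2nu _ Hx) (L2nu _ Hy)).
  by rewrite conjcK.
- by move=> x; have [] := HG x.
- by move=> f x Hf; have [_] := HG x; exact.
Qed.

End Equivalent_norm.

Section Dual_basis.
Context {d : measure_display} {X : measurableType d} {R : realType}.
Variables (mu : {measure set X -> \bar R}) (H : set (X -> R[i])).
Variable k : X -> X -> R[i].
Hypothesis Hk : is_rkhs mu H k.

Lemma L2dot_kernel_combination (n : nat) (p : 'I_n -> X) (v : 'I_n -> R[i]) f :
  H f -> L2dot mu (fun y => \sum_i v i * k y (p i)) f =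
         \sum_i v i * ((f (p i))^*)%C.
Proof.
move=> Hf; have Lf := rkhs_L2 Hk Hf.
have Lk x := in_L2_kernel mu H k Hk x.
rewrite (L2dot_suml mu _ _ (fun i y => v i * k y (p i)))//; last first.
  by move=> i; exact: in_L2Z.
apply: eq_bigr => i _; rewrite L2dotZl//.
by rewrite (L2dotC mu _ _ Lf (Lk _)) -(rkhs_reproducing Hk _ Hf).
Qed.

Lemma kernel_combination_mem (n : nat) (p : 'I_n -> X) (v : 'I_n -> R[i]) :
  H (fun y => \sum_i v i * k y (p i)).
Proof.
apply: (rkhs_sum mu H k Hk _ _ (fun i y => v i * k y (p i))) => i.
by apply: (rkhsZ mu H k Hk); exact: rkhs_kernel Hk _.
Qed.

(** Functions with Kronecker data force the Gram matrix [G] of the kernel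
    functions at [p] to be invertible, and the columns of its inverse give the
    dual basis [g] of their span.  Each [g j] is the orthogonal projection of an
    interpolating function, so its norm is no larger.  The sum in the last clause
    is the value at [y] of the projection [w] of [k . y] onto the span, which
    equals the squared norm of [w] and is therefore at most that of [k . y]. *)
Lemma dual_basis (n : nat) (p : 'I_n -> X) (M : R) :
  (forall j, exists g, [/\ H g, forall i, g (p i) = (i == j)%:R & nrm mu g <= M]) ->
  exists g : 'I_n -> X -> R[i], [/\ forall j, H (g j),
     forall j, g j (p j) = 1, forall j, nrm mu (g j) <= M &
     forall y, 0 <= \sum_j complex.Re (g j y * (k y (p j))^*)%C <= complex.Re (k y y)].
Proof.
move=> gt_ex.
have [gt gtP] : {gt : 'I_n -> X -> R[i] & forall j, [/\ H (gt j),
    forall i, gt j (p i) = (i == j)%:R & nrm mu (gt j) <= M]}.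
  exact: (@choice _ _ (fun j g => [/\ H g, forall i, g (p i) = (i == j)%:R & nrm mu g <= M])).
pose G : 'M[R[i]]_n := \matrix_(i, j) k (p i) (p j).
have GJ i j : ((G i j)^*)%C = G j i by rewrite !mxE -(rkhs_hermitian Hk).
have Gunit : G \in unitmx.
  rewrite -row_free_unit; apply/inj_row_free => v vG0; apply/rowP => l; rewrite mxE.
  pose w i := ((v 0 i)^*)%C.
  pose h y := \sum_i w i * k y (p i).
  have Hh : H h by exact: kernel_combination_mem.
  have Lh := rkhs_L2 Hk Hh.
  have hp j : h (p j) = 0.
    have : ((v *m G) 0 j)^*%C = 0 by rewrite vG0 mxE conjc0.
    rewrite mxE rmorph_sum/= => <-; apply: eq_bigr => i _.
    by rewrite rmorphM/= GJ mxE.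
  have nh : nsq mu h = 0.
    have := L2dot_self mu _ Lh; rewrite {1}/h L2dot_kernel_combination//.
    under eq_bigr do rewrite hp conjc0 mulr0.
    by rewrite big1// => /(congr1 (@complex.Re R)).
  have [Hg gp _] := gtP l.
  have := cauchy_schwarz mu _ _ Lh (rkhs_L2 Hk Hg).
  rewrite nh mul0r {1}/h L2dot_kernel_combination// (bigD1 l)//= big1; last first.
    by move=> i il; rewrite gp (negPf il) conjc0 mulr0.
  rewrite gp eqxx conjc1 mulr1 addr0 /w cmodJ exprn_even_le0//= => /eqP.
  exact: cmod_eq0.
pose D := invmx G.
pose g j y := \sum_i D i j * k y (p i).
have Hg j : H (g j) by exact: kernel_combination_mem.
have Lg j := rkhs_L2 Hk (Hg j).
have gp j l : g j (p l) = (l == j)%:R.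
  have := mulmxV Gunit => /matrixP/(_ l j); rewrite !mxE => <-.
  by apply: eq_bigr => i _; rewrite mxE mulrC.
exists g; split=> //.
- by move=> j; rewrite gp eqxx.
- move=> j; have [Hgt gtp gtM] := gtP j; apply: le_trans gtM.
  have Lgt := rkhs_L2 Hk Hgt.
  have E : L2dot mu (g j) (gt j) = L2dot mu (g j) (g j).
    rewrite {1 2}/g !L2dot_kernel_combination//.
    by apply: eq_bigr => i _; rewrite gtp gp.
  have := cmod_L2dot_le mu _ _ (Lg j) Lgt.
  rewrite E L2dot_self// cmod_real ?nsq_ge0// -nrm_sqr expr2.
  have [->|n0] := eqVneq (nrm mu (g j)) 0; first by rewrite nrm_ge0.
  by rewrite ler_pM2l// lt_def n0 nrm_ge0.
- move=> y; pose w z := \sum_j ((g j y)^*)%C * k z (p j).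
  have Hw : H w by exact: kernel_combination_mem.
  have Lw := rkhs_L2 Hk Hw.
  have wp l : w (p l) = k (p l) y.
    rewrite /w; under eq_bigr do rewrite /g rmorph_sum/= mulr_suml.
    rewrite exchange_big/= (bigD1 l)//= [X in _ + X]big1 ?addr0.
    + under eq_bigr do rewrite rmorphM/= -(rkhs_hermitian Hk) mulrAC.
      rewrite -mulr_suml (_ : \sum_i _ = 1) ?mul1r//.
      have := mulVmx Gunit => /matrixP/(_ l l); rewrite !mxE eqxx mulr1n => /(congr1 conjc).
      rewrite conjc1 rmorph_sum/= => <-; apply: eq_bigr => i _.
      by rewrite rmorphM/= GJ mxE.
    + move=> i il; under eq_bigr do rewrite rmorphM/= -(rkhs_hermitian Hk) mulrAC.
      rewrite -mulr_suml (_ : \sum_i _ = 0) ?mul0r//.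
      have := mulVmx Gunit => /matrixP/(_ i l); rewrite !mxE (negPf il) mulr0n => /(congr1 conjc).
      rewrite conjc0 rmorph_sum/= => E0; rewrite -[RHS]E0; apply: eq_bigr => j _.
      by rewrite rmorphM/= GJ mxE.
  have wy : w y = ((nsq mu w)%:C)%C.
    rewrite -L2dot_self// {2}/w L2dot_kernel_combination//.
    by apply: eq_bigr => j _; rewrite wp -(rkhs_hermitian Hk).
  have -> : \sum_j complex.Re (g j y * (k y (p j))^*)%C = nsq mu w.
    rewrite -[RHS]/(complex.Re ((nsq mu w)%:C)%C) -wy /w Re_sum.
    by apply: eq_bigr => j _; rewrite -[LHS]ReJ rmorphM/= conjcK.
  rewrite nsq_ge0/=; have := rkhs_eval_le mu H k Hk w y Hw.
  rewrite wy cmod_real ?nsq_ge0// expr2.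
  have [->|n0] := eqVneq (nsq mu w) 0; first by rewrite (kernel_diag_ge0 mu H k Hk).
  by rewrite ler_pM2l// lt_def n0 nsq_ge0.
Qed.

End Dual_basis.

(** * Sums over point sets and integrals against them *)

Section Integrals.
Context {d : measure_display} {X : measurableType d} {R : realType}.
Variable mu : {measure set X -> \bar R}.

(** The integral of a nonnegative function is a supremum over the simple
    functions below it, whether or not the function is measurable. *)
Lemma le_lower_integral (E : set X) (f g : X -> \bar R) :
  (forall x, E x -> 0 <= f x)%E -> (forall x, E x -> f x <= g x)%E ->
  (\int[mu]_(x in E) f x <= \int[mu]_(x in E) g x)%E.
Proof.
move=> f0 fg; have g0 x : E x -> (0 <= g x)%E.
  by move=> Ex; exact: le_trans (f0 _ Ex) (fg _ Ex).
rewrite !ge0_integralE//; apply: le_ereal_sup => _ [h /= hf <-].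
exists h => // x; apply: le_trans (hf x) _.
by rewrite !patchE; case: ifPn => // /set_mem; exact: fg.
Qed.

Lemma esum_finite_support (L : set X) (s : seq X) (v : X -> \bar R) :
  uniq s -> {in s, forall l, L l} -> (forall x, 0 <= v x)%E ->
  (forall l, L l -> l \notin s -> v l = 0%E) ->
  (\esum_(l in L) v l = \sum_(l <- s) v l)%E.
Proof.
move=> us sL v0 vs; rewrite (esumID [set` s])//.
rewrite [X in (_ + X)%E]esum1 ?adde0; last first.
  by move=> l [Ll /= /negP ls]; exact: vs.
rewrite (_ : L `&` [set` s] = [set` s]); last first.
  by apply/seteqP; split=> [l []|l ls]//; split=> //; exact: sL.
have fs : finite_set [set` s] by exact: finite_seq.
by rewrite (esum_fset fs (fun i _ => v0 i)); exact/esym/fsbig_seq.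
Qed.

Lemma counting_finite (A : set X) : finite_set A -> exists s : seq X,
  [/\ uniq s, (forall x, (x \in s) = (x \in A)) & counting A = ((size s)%:R%:E : \bar R)].
Proof.
move=> fA; exists (finmap.enum_fset (fset_set A)); split; first exact: finmap.fset_uniq.
  exact: in_fset_set.
by rewrite /counting asboolT.
Qed.

Lemma finite_set_bounded (A : set X) (N : R) :
  (forall s : seq X, uniq s -> {in s, forall x, A x} -> (size s)%:R <= N) ->
  finite_set A.
Proof.
move=> AN; apply: contrapT => infA.
have [B BA] := infinite_set_fset (Num.truncn N).+1 infA.
apply/negP; rewrite -ltnNge ltnS.
have := AN (finmap.enum_fset B) (finmap.fset_uniq B) (fun x xB => BA _ xB).
by move=> BN; rewrite truncn_ge_nat ?BN//; exact: le_trans BN.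
Qed.

(** The sum of the point masses along an enumeration of [L]. *)
Lemma atomic_measure (L : set X) : countable L ->
  exists nu : {measure set X -> \bar R}, forall f : X -> \bar R,
    (forall x, 0 <= f x)%E -> measurable_fun [set: X] f ->
    (\int[nu]_x f x = \esum_(l in L) f l)%E.
Proof.
move=> /countable_bijP[Bn]; rewrite card_eq_sym => /card_set_bijP[e be].
pose m n : {measure set X -> \bar R} :=
  if n \in Bn then [the {measure set X -> \bar R} of \d_(e n)]
  else [the {measure set X -> \bar R} of mzero].
exists [the {measure set X -> \bar R} of mseries m 0] => f f0 mf.
rewrite ge0_integral_measure_series//.
transitivity (\sum_(0 <= n <oo | n \in Bn) f (e n))%E.
  rewrite [RHS]eseries_mkcond; apply: eq_eseriesr => n _; rewrite /m.
  case: ifP => nB; last exact: integral_measure_zero.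
  by rewrite integral_dirac// diracT mul1e.
rewrite nneseries_esum// (reindex_esum Bn L e _)//.
by congr esum; apply/seteqP; split=> n /=; [move/set_mem|move/mem_set].
Qed.

Lemma atomic_Rintegral (L : set X) (nu : {measure set X -> \bar R})
    (s : seq X) (u : X -> R) :
  (forall f : X -> \bar R, (forall x, 0 <= f x)%E -> measurable_fun [set: X] f ->
    (\int[nu]_x f x = \esum_(l in L) f l)%E) ->
  measurable_fun [set: X] u -> uniq s -> {in s, forall l, L l} ->
  (forall l, L l -> l \notin s -> u l = 0) ->
  \int[nu]_x u x = \sum_(l <- s) u l.
Proof.
move=> nuE mu_ us sL u0; rewrite /Rintegral integralE.
have mE : measurable_fun [set: X] (EFin \o u) by exact/measurable_EFinP.
rewrite !nuE//; try exact: measurable_funepos; try exact: measurable_funeneg.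
rewrite !(esum_finite_support L s)//; last 2 first.
- by move=> l Ll ls; rewrite funenegE /= u0// ?oppr0 ?oppe0 maxxx.
- by move=> l Ll ls; rewrite funeposE /= u0// maxxx.
under eq_bigr do rewrite funeposE -EFin_max.
under [X in (_ - X)%E]eq_bigr do rewrite funenegE -EFinN -EFin_max.
rewrite !sumEFin /= -sumrB; apply: eq_bigr => l _.
by rewrite /Num.max; case: ltP => a; case: ltP => b; lra.
Qed.

End Integrals.

Lemma sqsum_ge_seq {R : realType} {d : measure_display} {X : metricMeasurableType R d}
    (L : set X) (f : X -> R[i]) (s : seq X) : uniq s -> {in s, forall l, L l} ->
  ((\sum_(l <- s) cmod (f l) ^+ 2)%:E <= sqsum L f)%E.
Proof.
move=> us sL; apply: esum_ge; exists [set` s].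
  by split; [exact: finite_seq|move=> l; exact: sL].
by rewrite -sumEFin le_eqVlt; apply/orP; left; apply/eqP; exact: fsbig_seq.
Qed.

Lemma esum_le_seq {R : realType} {T : choiceType} (L : set T) (a : T -> R) (V : R) :
  (forall s : seq T, uniq s -> {in s, forall l, L l} -> \sum_(l <- s) a l <= V) ->
  (\esum_(l in L) (a l)%:E <= V%:E)%E.
Proof.
move=> HV; apply: ge_ereal_sup => _ [A [fA AL] <-].
have us := finmap.fset_uniq (fset_set A).
rewrite -(fset_setK fA).
rewrite (_ : (\sum_(x \in _) _)%E = (\sum_(x <- finmap.enum_fset (fset_set A)) (a x)%:E)%E).
  rewrite sumEFin lee_fin; apply: HV => // l.
  by rewrite in_fset_set// => /set_mem; exact: AL.
exact/esym/fsbig_seq.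
Qed.

Lemma Rintegral_sum_cst {d : measure_display} {X : measurableType d} {R : realType}
  (mu : {measure set X -> \bar R}) (E : set X) (I : Type) (s : seq I)
  (u : I -> X -> R) (a : R) : measurable E -> (mu E < +oo)%E ->
  (forall i, mu.-integrable E (EFin \o u i)) ->
  mu.-integrable E (EFin \o (fun x => \sum_(i <- s) u i x + a)) /\
  \int[mu]_(x in E) (\sum_(i <- s) u i x + a) =
  \sum_(i <- s) (\int[mu]_(x in E) u i x) + a * fine (mu E).
Proof.
move=> mE fE iu; elim: s => [|i s [IH1 IH2]].
  split.
    apply: (@eq_integrable _ _ _ mu E mE (cst a%:E)).
      by move=> x _; rewrite /= big_nil add0r.
    apply/integrableP; split; first exact: measurable_cst.
    by rewrite integral_cst// lte_mul_pinfty.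
  under eq_Rintegral do rewrite big_nil add0r.
  by rewrite big_nil add0r Rintegral_cst.
split.
  have := integrableD mE (iu i) IH1; apply: eq_integrable => // x _.
  by rewrite /= big_cons -EFinD addrA.
under eq_Rintegral do rewrite big_cons -addrA.
by rewrite RintegralD// IH2 big_cons addrA.
Qed.

Lemma sumr_cst_seq (V : zmodType) (I : Type) (s : seq I) (a : V) :
  \sum_(i <- s) a = a *+ size s.
Proof. by rewrite big_const_seq count_predT iter_addr_0. Qed.

(** * Interpolating sets are uniformly minimal *)

Section Gliding_hump.
Context {R : realType} {d : measure_display} {X : metricMeasurableType R d}.
Variable mu : {measure set X -> \bar R}.
Variables (H : set (X -> R[i])) (k : X -> X -> R[i]).
Hypothesis Hk : is_rkhs mu H k.
Variable L : set X.
Hypothesis interp : is_interpolating H L.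

Lemma interp_delta (m : X) : exists2 g, H g &
  forall l, L l -> g l = (l == m)%:R.
Proof.
have [|g Hg gP] := interp (fun l => (l == m)%:R); last by exists g.
apply: (@le_lt_trans _ _ 1%:E); last exact: ltry.
apply: esum_le_seq => s us _.
have -> : \sum_(l <- s) cmod ((l == m)%:R : R[i]) ^+ 2 = (count_mem m s)%:R.
  elim: s {us} => [|l s IH]; first by rewrite big_nil.
  rewrite big_cons IH /= natrD; congr (_ + _).
  by case: (l == m); rewrite ?cmod0 ?expr0n// (_ : cmod _ = 1) ?expr1n// /cmod ComplexField.Normc.normc1.
by rewrite count_uniq_mem// lern1 leq_b1.
Qed.

(** A gliding hump argument, in place of the open mapping theorem for the
    restriction of [H] to [L].  If no bound works, choose inductively a bad pair,
    that is a point [lam n] and a finite set [S n], and then a size [t n.+1] so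
    small that all later terms can be corrected on [S n] at a cost of at most
    [t n] in norm.  The data [\sum_n t n * delta_(lam n)] are summable, hence
    interpolated by some [f] in [H].  Subtracting the terms before [n],
    correcting the terms after [n] on [S n] and dividing by the value at [lam n]
    turns [f] into a function that is [1] at [lam n] and [0] at the other points
    of [S n].  The badness of the pair then forces the norm of [f] to exceed [n],
    for every [n]. *)
Lemma uniform_minimality : exists M : R, forall (l : X) (s : seq X), uniq s ->
  L l -> {in s, forall m, L m} ->
  exists g, [/\ H g, g l = 1, {in s, forall m, m != l -> g m = 0} & nrm mu g <= M].
Proof.
apply: contrapT => noM.
have bad (M : R) : exists ls : X * seq X, [/\ uniq ls.2, L ls.1,
    {in ls.2, forall m, L m} & forall g, H g -> g ls.1 = 1 ->
      {in ls.2, forall m, m != ls.1 -> g m = 0} -> M < nrm mu g].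
  apply: contrapT => nobad; apply: noM; exists M => l s us Ll sL.
  apply: contrapT => nog; apply: nobad; exists (l, s); split=> // g Hg gl gs.
  by rewrite ltNge; apply/negP => gM; apply: nog; exists g.
have {bad} [bad badP] := choice bad.
have [gam gamP] : {gam : X -> X -> R[i] & forall m, H (gam m) /\
    forall l, L l -> gam m l = (l == m)%:R}.
  apply: (@choice _ _ (fun m g => H g /\ forall l, L l -> g l = (l == m)%:R)) => m.
  by have [g Hg gP] := interp_delta m; exists g.
have LH f : H f -> in_L2 mu f by move=> Hf; exact: (rkhs_L2 Hk Hf).
have Hgam m : H (gam m) by case: (gamP m).
have gamE m l : L l -> gam m l = (l == m)%:R by exact: (gamP m).2.
pose cost (s : seq X) : R := \sum_(m <- s) nrm mu (gam m).
have cost0 s : 0 <= cost s by apply: sumr_ge0 => m _; exact: nrm_ge0.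
(* The state [u] holds the next size [t n] and the partial sum [F n] of the
   interpolants. *)
pose pt n (u : R * (X -> R[i])) := bad ((n.+2%:R + nrm mu u.2) / u.1).
pose step n (u : R * (X -> R[i])) : R * (X -> R[i]) :=
  (u.1 / (2 * (1 + cost (pt n u).2)), fun x => (u.1%:C)%C * gam (pt n u).1 x + u.2 x).
pose st := fix st n := if n is n'.+1 then step n' (st n') else (1 : R, (fun=> 0) : X -> R[i]).
pose t n := (st n).1.
pose F n := (st n).2.
pose lam n := (pt n (st n)).1.
pose S n := (pt n (st n)).2.
have tS n : t n.+1 = t n / (2 * (1 + cost (S n))) by [].
have FS n : F n.+1 = (fun x => ((t n)%:C)%C * gam (lam n) x + F n x) by [].
have badn n := badP ((n.+2%:R + nrm mu (F n)) / t n).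
have c1 n : 0 < 2 * (1 + cost (S n)) by have := cost0 (S n); lra.
have t0 n : 0 < t n by elim: n => [|n IH]; rewrite ?tS ?divr_gt0.
have Llam n : L (lam n) by case: (badn n).
have SL n : {in S n, forall m, L m} by case: (badn n).
have uS n : uniq (S n) by case: (badn n).
have HF n : H (F n).
  elim: n => [|n IH]; first exact: (rkhs_zero Hk).
  by rewrite FS; exact: (rkhs_linear Hk).
have t_half n : t n.+1 <= t n / 2.
  rewrite tS ler_pM2l// lef_pV2 ?posrE//.
  by have := cost0 (S n); lra.
have t_cost n : 2 * t n.+1 * cost (S n) <= t n.
  rewrite tS; have -> : 2 * (t n / (2 * (1 + cost (S n)))) * cost (S n) =
      t n * (cost (S n) / (1 + cost (S n))).
    have c0 := cost0 (S n).
    by field; rewrite gt_eqF//; lra.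
  rewrite ler_piMr ?(ltW (t0 n))//.
  by have c0 := cost0 (S n); rewrite ler_pdivrMr; lra.
have t_inv n : t n <= n.+1%:R^-1.
  elim: n => [|n IH]; first by rewrite invr1.
  apply: le_trans (t_half n) _; apply: (@le_trans _ _ (n.+1%:R^-1 / 2)).
    by rewrite ler_wpM2r.
  by rewrite -invfM lef_pV2 ?posrE ?mulr_gt0// -natrM ler_nat; lia.
pose a n (m : X) := \sum_(j < n) t j * (m == lam j)%:R.
have FE n m : L m -> F n m = ((a n m)%:C)%C.
  move=> Lm; rewrite /a; elim: n => [|n IH]; first by rewrite big_ord0.
  rewrite FS IH big_ord_recr/= gamE// addrC rmorphD rmorphM/=.
  by rewrite rmorph_nat.
have aS n m : a n.+1 m = a n m + t n * (m == lam n)%:R by rewrite /a big_ord_recr.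
have a_mono n p m : (n <= p)%N -> a n m <= a p m.
  move=> /subnK <-; elim: (p - n)%N => [//|q IH].
  by rewrite addSn aS (le_trans IH)// lerDl mulr_ge0// ltW.
have a_tail n p m : (n <= p)%N -> a p m <= a n m + 2 * t n - 2 * t p.
  move=> /subnK <-; elim: (p - n)%N => [|q IH]; first by rewrite add0n addrK.
  rewrite addSn aS; have := t_half (q + n)%N; have := t0 (q + n)%N.
  have : t (q + n)%N * (m == lam (q + n)%N)%:R <= t (q + n)%N.
    by rewrite ler_piMr ?(ltW (t0 _))// lern1 leq_b1.
  lra.
have a_up n p m : a p m <= a n m + 2 * t n.
  have [np|/ltnW pn] := leqP n p.
    by have := a_tail n p m np; have := t0 p; lra.
  by have := a_mono p n m pn; have := t0 n; lra.
pose lim m := sup (range (a ^~ m)).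
have hsup m : has_sup (range (a ^~ m)).
  split; first by exists (a 0%N m); exists 0%N.
  by exists (a 0%N m + 2 * t 0%N) => _ [p _ <-]; exact: a_up.
have a_le n m : a n m <= lim m.
  by apply: ub_le_sup; [exact: (hsup m).2|exists n].
have lim_le n m : lim m <= a n m + 2 * t n.
  by apply: ge_sup; [exact: (hsup m).1|move=> _ [p _ <-]; exact: a_up].
have a0 n m : 0 <= a n m.
  by apply: sumr_ge0 => j _; rewrite mulr_ge0// ltW.
have lim0 m : 0 <= lim m by exact: le_trans (a0 0%N m) (a_le 0%N m).
have lim2 m : lim m <= 2.
  by have := lim_le 0%N m; rewrite /a big_ord0 add0r mulr1.
have sum_t n : \sum_(j < n) t j <= 2 - 2 * t n.
  elim: n => [|n IH]; first by rewrite big_ord0 /t/=; lra.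
  by rewrite big_ord_recr/=; have := t_half n; lra.
have sum_lim (s : seq X) : uniq s -> \sum_(m <- s) lim m <= 4.
  move=> us; pose n := (2 * size s)%N.
  apply: (@le_trans _ _ (\sum_(m <- s) (a n m + 2 * t n))); first exact: ler_sum.
  rewrite big_split/= sumr_cst_seq.
  have h1 : \sum_(m <- s) a n m <= 2.
    rewrite /a exchange_big/=; apply: (@le_trans _ _ (\sum_(j < n) t j)).
      apply: ler_sum => j _; rewrite -mulr_sumr ler_piMr ?(ltW (t0 _))//.
      have -> : \sum_(m <- s) ((m == lam j)%:R : R) = (count_mem (lam j) s)%:R.
        elim: (s) => [|m s' IH]; first by rewrite big_nil.
        by rewrite big_cons IH /= natrD.
      by rewrite count_uniq_mem// lern1 leq_b1.
    by have := sum_t n; have := t0 n; lra.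
  have h2 : (2 * t n) *+ size s <= 1.
    rewrite -mulr_natr; have := t_inv n; rewrite -[_^-1]mul1r ler_pdivlMr// => h.
    apply: le_trans h; rewrite mulrAC [leLHS]mulrC ler_wpM2l ?(ltW (t0 n))//.
    by rewrite -natrM ler_nat /n; lia.
  lra.
have [|f Hf fE] := interp (fun m => ((lim m)%:C)%C).
  apply: (@le_lt_trans _ _ 8%:E); last exact: ltry.
  apply: esum_le_seq => s us _.
  apply: (@le_trans _ _ (\sum_(m <- s) 2 * lim m)).
    apply: ler_sum => m _; rewrite cmod_real// expr2 ler_wpM2r//.
  by rewrite -mulr_sumr; have := sum_lim s us; lra.
have key n : n.+1%:R <= nrm mu f.
  pose h x := f x - F n x.
  have Hh : H h by exact: (rkhsB mu H k Hk).
  pose dn m := lim m - a n m.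
  have hE m : L m -> h m = ((dn m)%:C)%C.
    by move=> Lm; rewrite /h fE// FE// rmorphB.
  have dlam : t n <= dn (lam n).
    by have := a_le n.+1 (lam n); rewrite aS eqxx mulr1 /dn; lra.
  have dlam0 : 0 < dn (lam n) by apply: lt_le_trans dlam.
  have dother m : m != lam n -> 0 <= dn m <= 2 * t n.+1.
    move=> ml; have := a_le n m; have := lim_le n.+1 m.
    by rewrite aS (negPf ml) mulr0 addr0 /dn => h1 h2; apply/andP; split; lra.
  (* [corr] cancels the later terms of the data on [S n], except at [lam n]. *)
  pose cf m : R[i] := if m == lam n then 0 else ((- dn m)%:C)%C.
  pose corr x := \sum_(m <- S n) cf m * gam m x.
  have Hcfm m : H (fun x => cf m * gam m x) by exact: (rkhsZ mu H k Hk).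
  have Hcorr : H corr by exact: (rkhs_sum mu H k Hk _ _ (fun m x => cf m * gam m x)).
  have corr_at l : L l -> corr l = if l \in S n then cf l else 0.
    move=> Ll; rewrite /corr.
    rewrite (eq_big_seq (fun m => if l == m then cf l else 0)); last first.
      move=> m mS; rewrite gamE//.
      by case: eqP => [->|]; rewrite ?mulr1 ?mulr0.
    rewrite -big_mkcond/=; case: ifPn => lS.
      rewrite -big_filter (_ : [seq m <- S n | l == m] = [:: l]) ?big_seq1//.
      rewrite (eq_filter (a2 := pred1 l)); last by move=> m; rewrite /= eq_sym.
      exact: filter_pred1_uniq.
    by rewrite big_seq_cond big1// => m /andP[mS /eqP lm]; rewrite lm mS in lS.
  have ncorr : nrm mu corr <= t n.
    apply: le_trans (nrm_sum_le mu _ _ (fun m x => cf m * gam m x) _) _.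
      by move=> m; exact: LH.
    apply: le_trans (t_cost n); rewrite /cost mulr_sumr; apply: ler_sum => m _.
    rewrite nrmZ; last exact: LH.
    rewrite ler_wpM2r ?nrm_ge0// /cf; case: ifPn => ml.
      by rewrite cmod0 mulr_ge0// ltW.
    have /andP[d0 d1] := dother m ml.
    by rewrite rmorphN cmodN cmod_real.
  pose g x := (((dn (lam n))^-1)%:C)%C * (h x + corr x).
  have Hhc : H (fun x => h x + corr x) by exact: (rkhsD mu H k Hk).
  have Hg : H g by exact: (rkhsZ mu H k Hk).
  have gl : g (lam n) = 1.
    rewrite /g hE// corr_at// /cf eqxx if_same addr0 -rmorphM/= mulVf ?gt_eqF//.
  have gs : {in S n, forall m, m != lam n -> g m = 0}.
    move=> m mS ml; have Lm := SL n m mS.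
    by rewrite /g hE// corr_at// mS /cf (negPf ml) rmorphN/= subrr mulr0.
  have [_ _ _ /(_ g Hg gl gs)] := badn n.
  rewrite /g nrmZ; last exact: LH.
  rewrite cmod_real ?invr_ge0 ?(ltW dlam0)//.
  rewrite ltr_pdivrMr// mulrC => big.
  have big2 : n.+2%:R + nrm mu (F n) < nrm mu (fun x => h x + corr x).
    apply: lt_le_trans big _; rewrite mulrA ler_piMl ?nrm_ge0//.
    by rewrite ler_pdivrMr// mul1r.
  have h1 := nrmD mu _ _ (LH _ Hh) (LH _ Hcorr).
  have h2 : nrm mu h <= nrm mu f + nrm mu (F n).
    have := nrmD mu f (fun x => (-1) * F n x) (LH _ Hf) (in_L2Z mu _ _ (LH _ (HF n))).
    rewrite nrmZ; last exact: LH.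
    rewrite cmodN (_ : cmod 1 = 1) ?mul1r; last exact: ComplexField.Normc.normc1.
    by under [X in nrm mu X <= _]eq_fun do rewrite mulN1r.
  have h3 : t n <= 1 by apply: le_trans (t_inv n) _; rewrite invf_le1// ler1n.
  by move: big2; rewrite -natr1; lra.
have := key (Num.truncn (nrm mu f)).
by rewrite leNgt truncnS_gt.
Qed.

End Gliding_hump.

(** * Volume growth and localization of the kernel *)

Lemma uniform_cvg0 {R : realType} {T : Type} (F : R -> T -> \bar R) :
  ereal_sup (range (F r)) @[r --> +oo] --> (0 : \bar R)%E ->
  forall e : R, 0 < e -> exists2 M : R, 0 < M &
    forall r, M <= r -> forall x, (F r x < e%:E)%E.
Proof.
move=> cF e e0.
have : \forall r \near +oo, (ereal_sup (range (F r)) < e%:E)%E.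
  have /= := cF [set r | (r < e%:E)%E]; apply.
  by apply: open_nbhs_nbhs; split; [exact: open_ereal_lt_ereal|rewrite /= lte_fin].
move=> [M [_ HM]]; exists (Num.max M 0 + 1).
  by rewrite ltr_wpDl// le_max lexx orbT.
move=> r Mr x; apply: le_lt_trans (HM r _).
  by apply: ereal_sup_ubound; exists x.
by apply: lt_le_trans Mr; rewrite ltr_pwDr// le_max lexx.
Qed.

Section Density.
Context {R : realType} {d : measure_display} {X : metricMeasurableType R d}.
Variable mu : {measure set X -> \bar R}.
Hypothesis mdist_meas : measurable_fun [set: X * X]
     (fun p : X * X => mdist p.1 p.2 : R).
Hypothesis ball_fin : forall (x : X) (r : R), 0 < r -> (mu (ball x r) < +oo)%E.
Implicit Types (x y z : X) (r s : R).

Lemma mem_ballE x r y : ball x r y = (mdist x y < r) :> Prop.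
Proof. by rewrite ballEmdist. Qed.

Lemma in_ball x r y : (y \in (ball x r : set X)) = (mdist x y < r).
Proof. by apply/idP/idP => [/set_mem|?]; [|apply/mem_set]; rewrite mem_ballE. Qed.

Lemma measurable_mdist x : measurable_fun [set: X] (fun y => mdist x y : R).
Proof.
have := measurableT_comp mdist_meas (measurable_pair1 x).
exact.
Qed.

Lemma measurable_mball x r : measurable (ball x r).
Proof.
rewrite (_ : ball x r = [set: X] `&` (fun y => mdist x y : R) @^-1` `]-oo, r[%classic).
  by apply: measurable_mdist.
by apply/seteqP; split=> y; rewrite setTI /= mem_ballE in_itv.
Qed.

Definition vol x r : R := fine (mu (ball x r)).

Lemma volE x r : mu (ball x r) = (vol x r)%:E.
Proof.
rewrite /vol fineK// ge0_fin_numE//; have [r0|r0] := ltP 0 r; first exact: ball_fin.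
rewrite (_ : ball x r = set0) ?measure0//; apply/seteqP; split=> y //.
by rewrite mem_ballE ltNge (le_trans r0) ?mdist_ge0.
Qed.

Lemma vol_ge0 x r : 0 <= vol x r.
Proof. by rewrite -lee_fin -volE. Qed.

Lemma subset_mball x y r s : mdist x y + r <= s -> ball y r `<=` ball x s.
Proof.
move=> h z; rewrite !mem_ballE => yz.
by apply: le_lt_trans (metric_triangle x y z) _; apply: lt_le_trans h; rewrite ltrD2l.
Qed.

Lemma le_vol x r s : r <= s -> vol x r <= vol x s.
Proof.
move=> rs; rewrite -lee_fin -!volE le_measure ?inE//; try exact: measurable_mball.
by apply: subset_mball; rewrite mdistxx add0r.
Qed.

Lemma mu_annulus x r s : r <= s ->
  mu (ball x s `\` ball x r) = (vol x s - vol x r)%:E.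
Proof.
move=> rs; have m t := measurable_mball x t.
have fs : (mu (ball x s) < +oo)%E by rewrite volE ltry.
have -> : mu (ball x s `\` ball x r) = (mu (ball x s) - mu (ball x s `&` ball x r))%E.
  exact: measureD.
rewrite setIidr; last by apply: subset_mball; rewrite mdistxx add0r.
by rewrite !volE EFinB.
Qed.

Lemma vol_gt0_eventually : (exists2 r : R, 0 < r &
     (0 < ereal_inf (range (fun x : X => mu (ball x r))))%E) ->
  exists2 r : R, 0 < r & forall s, r <= s -> forall x, 0 < vol x s.
Proof.
move=> [r r0 Hr]; exists r => // s rs x; apply: lt_le_trans (le_vol x r s rs).
rewrite -lte_fin -volE; apply: lt_le_trans Hr _.
by apply: ereal_inf_lbound; exists x.
Qed.

Hypothesis annular_decay :
     (ereal_sup (range (fun x : X =>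
       mu (ball x r `\` ball x (r - 1)%R) / mu (ball x r)))
       @[r --> +oo%R] --> (0 : \bar R))%E.
Hypothesis vol_gt0 : exists2 r : R, 0 < r & forall s, r <= s -> forall x, 0 < vol x s.

Lemma vol_growth1 (e : R) : 0 < e -> exists2 s0, 0 < s0 & forall s, s0 <= s ->
  forall x, vol x (s + 1) <= (1 + e) * vol x s.
Proof.
move=> e0; have [r0 r00 Hr0] := vol_gt0.
have e1 : 0 < e / (1 + e) by apply: divr_gt0 => //; lra.
have [M M0 HM] := uniform_cvg0 _ annular_decay _ e1.
exists (M + r0) => [|s Ms x]; first lra.
have := HM (s + 1) _ x; rewrite addrK mu_annulus ?lerDl//.
have v0 : 0 < vol x (s + 1) by apply: Hr0; lra.
rewrite volE inver gt_eqF//= -EFinM lte_fin => /(_ _)/ltW.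
rewrite ler_pdivrMr// => H.
have {H} := H ltac:(lra).
rewrite mulrAC ler_pdivlMr; last by lra.
move: (vol x (s + 1)) (vol x s) => a b; nra.
Qed.

(** Annular decay makes the volume grow by a factor close to [1] over a step of
    length [1], uniformly in the centre, hence also over [n] steps. *)
Lemma vol_growth (n : nat) (e : R) : 0 < e -> exists2 s0, 0 < s0 &
  forall s, s0 <= s -> forall x, vol x (s + n%:R) <= (1 + e) * vol x s.
Proof.
elim: n e => [|n IH] e e0.
  exists 1 => // s _ x; rewrite addr0 mulrDl mul1r lerDl mulr_ge0 ?vol_ge0//; exact: ltW.
pose e1 := Num.min (e / 3) 1.
have e10 : 0 < e1 by rewrite lt_min divr_gt0/=.
have e1e : e1 <= e / 3 by rewrite ge_min lexx.
have e11 : e1 <= 1 by rewrite ge_min lexx orbT.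
have [s1 s10 H1] := IH e1 e10; have [s2 s20 H2] := vol_growth1 e1 e10.
exists (s1 + s2) => [|s Hs x]; first lra.
have n0 : 0 <= n%:R :> R by [].
rewrite -natr1 addrA; apply: le_trans (H2 _ _ x) _; first lra.
have := H1 s ltac:(lra) x; have := vol_ge0 x s.
move: (vol x s) (vol x (s + n%:R)) => a b a0 ba.
apply: (@le_trans _ _ ((1 + e1) * ((1 + e1) * a))).
  by rewrite ler_wpM2l//; lra.
rewrite mulrA ler_wpM2r//; nra.
Qed.

Variables (H : set (X -> R[i])) (k : X -> X -> R[i]).
Hypothesis Hk : is_rkhs mu H k.
Variables (C sigma : R).
Hypotheses (C_gt0 : 0 < C) (sigma_gt0 : 0 < sigma).
Hypothesis off_diag : forall x y : X,
     cmod (k x y) <= C * (1 + mdist x y) `^ (- sigma).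
Variable c : R.
Hypothesis c_gt0 : 0 < c.
Hypothesis diag_ge : forall x, c <= complex.Re (k x x).

Let kdiag x := complex.Re (k x x).

(** The integrand of the tail condition; up to the factor [C ^+ 2] it dominates
    the squared modulus of the kernel. *)
Definition decay x y : R := (1 + mdist x y) `^ (- (2 * sigma)).

Lemma decay_ge0 x y : 0 <= decay x y. Proof. exact: powR_ge0. Qed.

Lemma measurable_decay x : measurable_fun [set: X] (decay x).
Proof.
apply: (measurableT_comp (measurable_powR _)).
by apply: measurable_funD => //; exact: measurable_mdist.
Qed.

Lemma kernel_sym_cmod x y : cmod (k y x) = cmod (k x y).
Proof. by rewrite (rkhs_hermitian Hk) cmodJ. Qed.

Lemma kernel_sqr_le x y : cmod (k y x) ^+ 2 <= C ^+ 2 * decay x y.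
Proof.
rewrite kernel_sym_cmod /decay (_ : - (2 * sigma) = - sigma * 2%:R); last by ring.
rewrite powRrM powR_mulrn ?powR_ge0// -exprMn.
by rewrite ler_pXn2r// nnegrE ?cmod_ge0// mulr_ge0 ?powR_ge0// ltW.
Qed.

Lemma kernel_diag_le x : complex.Re (k x x) <= C.
Proof.
apply: le_trans (Re_le_cmod _) _; have := off_diag x x.
by rewrite mdistxx addr0 powR1 mulr1.
Qed.

Lemma nsq_kernel_le x : nsq mu (fun y => k y x) <= C.
Proof. by rewrite (nsq_kernel mu H k Hk) kernel_diag_le. Qed.

Hypothesis tail_decay :
     (ereal_sup (range (fun x : X =>
       \int[mu]_(y in ~` ball x r)
         ((1 + mdist x y) `^ (- (2 * sigma)))%R%:E))
       @[r --> +oo%R] --> (0 : \bar R))%E.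

Lemma decay_tail (e : R) : 0 < e -> exists2 rho, 0 < rho & forall r, rho <= r ->
  forall x, (\int[mu]_(y in ~` ball x r) (decay x y)%:E <= e%:E)%E.
Proof.
move=> e0; have [M M0 HM] := uniform_cvg0 _ tail_decay _ e0.
by exists M => // r Mr x; exact/ltW/HM.
Qed.

Lemma kernel_tail (e : R) : 0 < e -> exists2 rho, 0 < rho & forall r, rho <= r ->
  forall x, nsq mu (restr (~` ball x r) (fun y => k y x)) <= e.
Proof.
move=> e0; have C20 : 0 < C ^+ 2 by rewrite exprn_gt0.
have [rho rho0 H1] := decay_tail _ (divr_gt0 e0 C20); exists rho => // r rr x.
have mB : measurable (~` ball x r) by apply: measurableC; exact: measurable_mball.
rewrite -lee_fin nsq_restr//; last exact: in_L2_kernel mu H k Hk _.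
have mw : measurable_fun (~` ball x r) (EFin \o decay x).
  by apply/measurable_EFinP/measurable_funTS; exact: measurable_decay.
apply: (@le_trans _ _ (\int[mu]_(y in ~` ball x r) ((C ^+ 2)%:E * (decay x y)%:E))%E).
  apply: ge0_le_integral => //.
  - by move=> y _; rewrite lee_fin sqr_ge0.
  - apply/measurable_EFinP/measurable_funTS/cmeasurable_cmod_sqr.
    by case: (in_L2_kernel mu H k Hk x).
  - exact: measurable_funeM.
  - by move=> y _; rewrite -EFinM lee_fin kernel_sqr_le.
rewrite ge0_integralZl_EFin//; last by rewrite ltW.
  by rewrite muleC -lee_pdivlMr// -EFinM H1.
by move=> y _; rewrite lee_fin decay_ge0.
Qed.

Section Bessel.
Variables (L : set X) (B rho0 : R).
Hypothesis bessel : forall f, H f -> forall s : seq X, uniq s ->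
  {in s, forall l, L l} -> \sum_(l <- s) cmod (f l) ^+ 2 <= B * nsq mu f.
Hypothesis B_ge0 : 0 <= B.
Hypothesis rho0_tail : forall x,
  nsq mu (restr (~` ball x rho0) (fun y => k y x)) <= c / 2.

(** Each kernel function [k . l] keeps at least half of its squared norm, which is
    at least [c], inside [ball l rho0].  So a sum of [v] over the points is
    bounded by the integral of [w] against [\sum_l |k z l|^2], and the Bessel
    inequality for [k . z] bounds the latter sum by [B * C].  This replaces a
    bound on the number of points per unit ball: balls of a fixed radius may
    have unbounded measure. *)
Lemma weighted_count (s : seq X) (v w : X -> R) : uniq s ->
  {in s, forall l, L l} -> measurable_fun [set: X] w ->
  (forall l, 0 <= v l) -> (forall z, 0 <= w z) ->
  {in s, forall l z, mdist l z < rho0 -> v l <= w z} ->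
  ((\sum_(l <- s) v l * (c / 2))%:E <= (B * C)%:E * \int[mu]_z (w z)%:E)%E.
Proof.
move=> us sL mw v0 w0 vw.
have mk l : measurable_fun [set: X] (fun z => cmod (k z l) ^+ 2).
  by apply: cmeasurable_cmod_sqr; case: (in_L2_kernel mu H k Hk l).
have mwk l : measurable_fun [set: X] (fun z => (w z * cmod (k z l) ^+ 2)%:E).
  by apply/measurable_EFinP/measurable_funM.
have wk0 l z : (0 <= (w z * cmod (k z l) ^+ 2)%:E)%E.
  by rewrite lee_fin mulr_ge0 ?sqr_ge0.
apply: (@le_trans _ _ (\sum_(l <- s) \int[mu]_z (w z * cmod (k z l) ^+ 2)%:E))%E.
  rewrite -sumEFin; rewrite big_seq [leRHS]big_seq; apply: lee_sum => l ls.
  have mB : measurable (ball l rho0) by exact: measurable_mball.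
  have hl : c / 2 <= nsq mu (restr (ball l rho0) (fun y => k y l)).
    have := nsq_restrC mu (ball l rho0) (fun y => k y l) mB (in_L2_kernel mu H k Hk l).
    rewrite (nsq_kernel mu H k Hk).
    by have := diag_ge l; have := rho0_tail l; lra.
  apply: (@le_trans _ _ (v l * nsq mu (restr (ball l rho0) (fun y => k y l)))%:E).
    by rewrite lee_fin ler_wpM2l.
  have Lr := in_L2_restr mu (ball l rho0) _ mB (in_L2_kernel mu H k Hk l).
  have mr : measurable_fun [set: X] (fun z => cmod (restr (ball l rho0) (fun y => k y l) z) ^+ 2).
    by apply: cmeasurable_cmod_sqr; case: Lr.
  rewrite EFinM -nsqE// /sqint -ge0_integralZl_EFin//; last 2 first.
    by move=> z _; rewrite lee_fin sqr_ge0.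
    exact/measurable_EFinP.
  apply: ge0_le_integral => //.
  - by move=> z _; rewrite -EFinM lee_fin mulr_ge0// sqr_ge0.
  - by apply: measurable_funeM; exact/measurable_EFinP.
  - move=> z _; rewrite -EFinM lee_fin /restr in_ball; case: ifP => lz.
      by rewrite ler_wpM2r ?sqr_ge0// vw.
    by rewrite cmod0 expr0n mulr0 mulr_ge0 ?sqr_ge0.
rewrite -ge0_integral_sum//.
rewrite -ge0_integralZl_EFin//; last 3 first.
- by move=> z _; rewrite lee_fin.
- exact/measurable_EFinP.
- by rewrite mulr_ge0// ltW.
apply: ge0_le_integral => //.
- by move=> z _; apply: sume_ge0 => l _; exact: wk0.
- by apply: emeasurable_sum => l.
- by apply: measurable_funeM; exact/measurable_EFinP.
- move=> z _; rewrite sumEFin -EFinM lee_fin -mulr_sumr mulrC ler_wpM2r//.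
  have Hz := rkhs_kernel Hk z.
  apply: le_trans (ler_wpM2l B_ge0 (nsq_kernel_le z)).
  apply: le_trans (bessel _ Hz s us sL).
  by apply: ler_sum => l _; rewrite kernel_sym_cmod.
Qed.

Lemma count_le (s : seq X) (E : set X) (V : R) : uniq s -> {in s, forall l, L l} ->
  measurable E -> mu E = V%:E -> {in s, forall l, ball l rho0 `<=` E} ->
  (size s)%:R <= (2 * B * C / c) * V.
Proof.
move=> us sL mE muE sE.
have vw : {in s, forall l z, mdist l z < rho0 -> (1 : R) <= (\1_E z : R)}.
  by move=> l ls z lz; rewrite indicE mem_set//; apply: (sE l ls); rewrite mem_ballE.
have := weighted_count s (fun=> 1) (\1_E) us sL (measurable_indic mE)
  (fun=> ler01) (fun z => ler0n _ _) vw.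
rewrite integral_indic// setIT muE -EFinM lee_fin.
rewrite -mulr_suml big_const_seq count_predT iter_addr_0.
rewrite -ler_pdivlMr; last by rewrite divr_gt0.
move=> H1; apply: (le_trans H1); clear muE.
by rewrite le_eqVlt; apply/orP; left; apply/eqP; field; rewrite gt_eqF.
Qed.

(** The homogeneous approximation property: apply [weighted_count] with [v] the
    decay function centred at [y] and [w] a multiple of its restriction to the
    complement of a ball around [y].  Moving by less than [rho0] changes
    [1 + mdist y l] at most by the factor [1 + rho0]. *)
Lemma kernel_bessel_tail (e : R) : 0 < e -> exists2 rho, 0 < rho &
  forall y (s : seq X), uniq s -> {in s, forall l, L l} ->
  {in s, forall l, rho <= mdist y l} -> \sum_(l <- s) cmod (k l y) ^+ 2 <= e.
Proof.
move=> e0.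
pose p := 2 * sigma.
have p0 : 0 <= p by rewrite mulr_ge0// ltW.
pose r1 := `|rho0|.
pose q := (1 + r1) `^ p.
have r10 : 0 <= r1 by exact: normr_ge0.
have q0 : 0 < q by rewrite powR_gt0//; lra.
(* [Z] collects the constants lost along the way; adding [1] makes it positive
   when [B] vanishes. *)
pose Z := C ^+ 2 * (2 / c) * (B * C * q) + 1.
have C20 : 0 < C ^+ 2 by rewrite exprn_gt0.
have Z1 : 0 <= C ^+ 2 * (2 / c) * (B * C * q).
  by rewrite !mulr_ge0 ?invr_ge0// ltW.
have Z0 : 0 < Z by rewrite /Z; lra.
have [rho rho_gt0 Hrho] := decay_tail _ (divr_gt0 e0 Z0).
exists (rho + r1) => [|y s us sL sy]; first lra.
have mB : measurable (~` ball y rho) by apply: measurableC; exact: measurable_mball.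
pose w z := q * (decay y z * \1_(~` ball y rho) z).
have mw1 : measurable_fun [set: X] (fun z => decay y z * \1_(~` ball y rho) z).
  by apply: measurable_funM; [exact: measurable_decay|exact: measurable_indic].
have mw : measurable_fun [set: X] w by exact: measurable_funM.
have w0 z : 0 <= w z by rewrite !mulr_ge0 ?decay_ge0// ltW.
have vw : {in s, forall l z, mdist l z < rho0 -> decay y l <= w z}.
  move=> l ls z lz; have yl := sy l ls.
  have tri1 := metric_triangle y z l; rewrite (metric_sym z l) in tri1.
  have tri2 := metric_triangle y l z.
  have lr1 : mdist l z <= r1 by rewrite (le_trans (ltW lz))// ler_norm.
  rewrite /w indicE mem_set ?mulr1; last by rewrite /= mem_ballE; apply/negP; rewrite -leNgt; lra.
  rewrite /decay !powRN -/p.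
  have a0 : 0 <= mdist y l by exact: mdist_ge0.
  have b0 : 0 <= mdist y z by exact: mdist_ge0.
  rewrite ler_pdivlMr ?powR_gt0//; last by lra.
  rewrite ler_pdivrMl ?powR_gt0//; last by lra.
  rewrite mulrC -powRM; try lra.
  apply: ge0_ler_powR => //; rewrite ?nnegrE; nra.
have := weighted_count s (decay y) w us sL mw (decay_ge0 y) w0 vw.
have -> : (\int[mu]_z (w z)%:E = q%:E * \int[mu]_(z in ~` ball y rho) (decay y z)%:E)%E.
  rewrite [in RHS]integral_mkcond -ge0_integralZl_EFin//; last 3 first.
  - by move=> z _; rewrite patchE; case: ifP => // _; rewrite lee_fin decay_ge0.
  - apply/(measurable_restrictT _ mB)/measurable_EFinP/measurable_funTS.
    exact: measurable_decay.
  - exact: ltW.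
  apply: eq_integral => z _; rewrite /w EFinM patchE indicE.
  by case: (z \in _); rewrite ?mulr1 ?mulr0.
move=> H1.
have {H1} : \sum_(l <- s) decay y l * (c / 2) <= B * C * q * (e / Z).
  rewrite -lee_fin; apply: le_trans H1 _; rewrite muleA -EFinM.
  rewrite [leRHS]EFinM lee_wpmul2l ?Hrho// lee_fin.
  by rewrite !mulr_ge0// ltW.
rewrite -mulr_suml => H1.
apply: (@le_trans _ _ (C ^+ 2 * \sum_(l <- s) decay y l)).
  by rewrite mulr_sumr; apply: ler_sum => l _; exact: kernel_sqr_le.
have H2 : \sum_(l <- s) decay y l <= (2 / c) * (B * C * q * (e / Z)).
  have -> : \sum_(l <- s) decay y l = (2 / c) * ((\sum_(l <- s) decay y l) * (c / 2)).
    by field; rewrite gt_eqF.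
  by rewrite ler_wpM2l// divr_ge0// ltW.
apply: le_trans (ler_wpM2l (ltW C20) H2) _.
have -> : C ^+ 2 * (2 / c * (B * C * q * (e / Z))) = (Z - 1) * e / Z.
  by rewrite /Z addrK; ring.
by rewrite ler_pdivrMr// mulrC ler_wpM2l ?(ltW e0)// gerBl.
Qed.

End Bessel.

(** * Sampling sets *)

Section Sampling.
Variables (L : set X) (A B : R).
Hypotheses (A_gt0 : 0 < A) (B_gt0 : 0 < B).
Hypothesis lowA : forall f, H f -> ((A * nsq mu f)%:E <= sqsum L f)%E.
Hypothesis upB : forall f, H f -> (sqsum L f <= (B * nsq mu f)%:E)%E.

Lemma bessel_of_sampling f : H f -> forall s : seq X, uniq s ->
  {in s, forall l, L l} -> \sum_(l <- s) cmod (f l) ^+ 2 <= B * nsq mu f.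
Proof.
move=> Hf s us sL; rewrite -lee_fin; apply: le_trans (upB f Hf).
exact: sqsum_ge_seq.
Qed.

(** Beyond this radius a kernel function has lost at most half of the lower bound
    [c] for its squared norm. *)
Lemma kernel_mass_radius : exists2 rho0 : R, 0 < rho0 & forall r, rho0 <= r -> forall x,
  nsq mu (restr (~` ball x r) (fun y => k y x)) <= c / 2.
Proof.
exact: (kernel_tail _
  (divr_gt0 c_gt0 (ltr0Sn _ 1))).
Qed.

Lemma relative_separation : exists rho0 D, [/\ 0 < rho0, 0 <= D,
   (forall x r (s : seq X), uniq s -> {in s, forall l, L l} ->
     {in s, forall l, mdist x l <= r - rho0} -> (size s)%:R <= D * vol x r) &
   (forall x r1 r2 (s : seq X), r1 <= r2 -> uniq s -> {in s, forall l, L l} ->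
     {in s, forall l, mdist x l <= r2 - rho0 /\ r1 + rho0 <= mdist x l} ->
     (size s)%:R <= D * (vol x r2 - vol x r1))].
Proof.
have [rho0 rho00 Hrho] := kernel_mass_radius.
have cnt := count_le L B rho0 bessel_of_sampling (ltW B_gt0) (Hrho rho0 (lexx _)).
exists rho0, (2 * B * C / c); split=> //.
- by rewrite !mulr_ge0// ?invr_ge0 ltW.
- move=> x r s us sL sr; apply: (cnt s (ball x r)) => //.
  + exact: measurable_mball.
  + exact: volE.
  + by move=> l ls; apply: subset_mball; have := sr l ls; lra.
- move=> x r1 r2 s r12 us sL sr; apply: (cnt s (ball x r2 `\` ball x r1)) => //.
  + by apply: measurableD; exact: measurable_mball.
  + exact: mu_annulus.
  + move=> l ls z; have [s1 s2] := sr l ls.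
    rewrite mem_ballE => lz; split.
      rewrite mem_ballE; have := metric_triangle x l z; lra.
    rewrite /= mem_ballE; apply/negP; rewrite -leNgt.
    have := metric_triangle x z l; rewrite (metric_sym z l); lra.
Qed.

Lemma finite_in_ball x r : finite_set (L `&` ball x r).
Proof.
have [rho0 [D [rho00 D0 cnt _]]] := relative_separation.
apply: (finite_set_bounded _ (D * vol x (r + rho0))) => s us sL.
apply: cnt => //; first by move=> l ls; have [] := sL l ls.
by move=> l ls; have [_] := sL l ls; rewrite mem_ballE addrK => /ltW.
Qed.

Lemma sampling_countable : countable L.
Proof.
rewrite (_ : L = \bigcup_(n in [set: nat]) (L `&` ball (point : X) n%:R)).
  apply: bigcup_countable => [|n _]; first exact: countableP.
  exact/finite_set_countable/finite_in_ball.
apply/seteqP; split=> [l Ll|l [n _ []]//].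
exists (Num.truncn (mdist (point : X) l)).+1 => //; split=> //.
by rewrite mem_ballE truncnS_gt.
Qed.

(** [k'] is the kernel of the dual frame: the functions [k' . l] with [l] in [L]
    expand every [f] in [H] as [\sum_(l in L) f l * k' . l]. *)
Lemma dual_kernel : exists nu : {measure set X -> \bar R}, exists k' : X -> X -> R[i],
  [/\ forall f : X -> \bar R, (forall x, 0 <= f x)%E -> measurable_fun [set: X] f ->
    (\int[nu]_x f x = \esum_(l in L) f l)%E,
    is_rkhs nu H k', forall f, H f -> in_L2 nu f &
   forall f, H f -> A * nsq mu f <= nsq nu f].
Proof.
have [nu nuE] := atomic_measure (R := R) L sampling_countable.
have sqE f : H f -> sqint nu f = sqsum L f.
  move=> Hf; rewrite /sqint nuE// => [x|]; first by rewrite lee_fin sqr_ge0.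
  by apply/measurable_EFinP/cmeasurable_cmod_sqr; case: (rkhs_L2 Hk Hf).
have Lnu f : H f -> in_L2 nu f.
  move=> Hf; apply/in_L2P; split; first by case: (rkhs_L2 Hk Hf).
  by rewrite sqE//; apply: le_lt_trans (upB f Hf) _; rewrite ltry.
have lA f : H f -> A * nsq mu f <= nsq nu f.
  by move=> Hf; rewrite -lee_fin -nsqE ?sqE ?lowA//; exact: Lnu.
have uB f : H f -> nsq nu f <= B * nsq mu f.
  by move=> Hf; rewrite -lee_fin -nsqE ?sqE ?upB//; exact: Lnu.
have [k' Hk'] := equivalent_rkhs mu nu H k Hk Lnu A B A_gt0 lA uB.
by exists nu, k'.
Qed.

(** With [t = k' y y], the squared norm of [k' . y] in [L2(nu)]: evaluation at [y]
    in [L2(mu)] gives [t ^ 2 <= t * C / A], and for [l] in [L] keeping a single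
    term of the sum defining [t] gives [t ^ 2 <= t]. *)
Lemma dual_kernel_bounds (nu : {measure set X -> \bar R}) (k' : X -> X -> R[i]) :
  (forall f : X -> \bar R, (forall x, 0 <= f x)%E -> measurable_fun [set: X] f ->
    (\int[nu]_x f x = \esum_(l in L) f l)%E) ->
  is_rkhs nu H k' -> (forall f, H f -> in_L2 nu f) ->
  (forall f, H f -> A * nsq mu f <= nsq nu f) ->
  [/\ forall y, nsq nu (fun z => k' z y) <= C / A,
     forall l, L l -> complex.Re (k' l l) <= 1 &
     forall l, L l -> nsq mu (fun z => k' z l) <= A^-1].
Proof.
move=> nuE Hk' Lnu lA.
have nd y := nsq_kernel nu H k' Hk' y.
have le1 l : L l -> complex.Re (k' l l) <= 1.
  move=> Ll; have Hl := rkhs_kernel Hk' l.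
  have t0 : 0 <= complex.Re (k' l l) by rewrite -nd nsq_ge0.
  have : complex.Re (k' l l) ^+ 2 <= complex.Re (k' l l).
    rewrite -[leRHS]nd -lee_fin -nsqE; last exact: Lnu.
    rewrite /sqint nuE; last 2 first.
    - by move=> x; rewrite lee_fin sqr_ge0.
    - by apply/measurable_EFinP/cmeasurable_cmod_sqr; case: (Lnu _ Hl).
    have lL : {in [:: l], forall z, L z} by move=> z; rewrite inE => /eqP ->.
    have S := sqsum_ge_seq L (fun z => k' z l) [:: l] isT lL.
    rewrite big_seq1 in S; apply: le_trans S.
    by rewrite lee_fin ler_pXn2r ?nnegrE ?cmod_ge0//; exact: Re_le_cmod.
  by move: (complex.Re _) t0 => t t0; nra.
split=> //.
- move=> y; have Hy := rkhs_kernel Hk' y.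
  have := rkhs_eval_le mu H k Hk _ y Hy.
  have := kernel_diag_le y.
  have := lA _ Hy; have := nsq_ge0 mu (fun z => k' z y).
  have : nsq nu (fun z => k' z y) ^+ 2 <= cmod (k' y y) ^+ 2.
    rewrite nd ler_pXn2r ?nnegrE ?cmod_ge0 ?Re_le_cmod//.
    by rewrite -nd nsq_ge0.
  have := nsq_ge0 nu (fun z => k' z y).
  move: (nsq nu _) (nsq mu _) (cmod _ ^+ 2) (complex.Re (k y y)) => t m q K.
  move=> t0 tq m0 At KC qmK; rewrite ler_pdivlMr//.
  have [->|tn0] := eqVneq t 0; first by rewrite mul0r ltW.
  have tp : 0 < t by rewrite lt_def tn0.
  rewrite -(ler_pM2l tp).
  have : A * (m * K) <= A * (m * C) by rewrite !ler_wpM2l// ltW.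
  have : A * m * C <= t * C by rewrite ler_wpM2r// ltW.
  have : A * t ^+ 2 <= A * (m * K) by rewrite ler_pM2l//; exact: le_trans qmK.
  rewrite expr2; lra.
- move=> l Ll; have Hl := rkhs_kernel Hk' l.
  have := lA _ Hl; have := le1 l Ll; rewrite nd => h1 h2.
  by rewrite -[A^-1]mul1r ler_pdivlMr// mulrC; exact: le_trans h2 h1.
Qed.

(** [k y y] is the [L2(nu)] inner product of [k . y] and [k' . y].  The points of
    [L] listed in [s] give the sum, and the Cauchy-Schwarz inequality bounds the
    remaining part by the tail of [k . y] along [L]. *)
Lemma pointwise_estimate (nu : {measure set X -> \bar R}) (k' : X -> X -> R[i]) :
  (forall f : X -> \bar R, (forall x, 0 <= f x)%E -> measurable_fun [set: X] f ->
    (\int[nu]_x f x = \esum_(l in L) f l)%E) ->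
  is_rkhs nu H k' -> (forall f, H f -> in_L2 nu f) ->
  (forall y, nsq nu (fun z => k' z y) <= C / A) ->
  forall eta : R, 0 < eta -> exists2 rho1 : R, 0 < rho1 & forall rho, rho1 <= rho ->
  forall x r (s : seq X), uniq s ->
  (forall l, (l \in s) = (l \in L `&` ball x (r + rho))) ->
  forall y, mdist x y < r ->
  kdiag y <= \sum_(l <- s) complex.Re (k' y l * (k y l)^*)%C + eta.
Proof.
move=> nuE Hk' Lnu nk' eta eta0.
have CA0 : 0 < C / A by rewrite divr_gt0.
have [rho0 _ Hrho0] := kernel_mass_radius.
have e0 : 0 < eta ^+ 2 / (C / A) by rewrite divr_gt0// exprn_gt0.
have [rho1 rho10 Hrho1] := kernel_bessel_tail L B rho0 bessel_of_sampling (ltW B_gt0) (Hrho0 rho0 (lexx _)) _ e0.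
exists rho1 => // rho rr x r s us sE y xy.
have Hy := rkhs_kernel Hk y; have Hy' := rkhs_kernel Hk' y.
have Ly := Lnu _ Hy; have Ly' := Lnu _ Hy'.
pose E : set X := ball x (r + rho).
have mE : measurable E by exact: measurable_mball.
rewrite /kdiag (rkhs_reproducing Hk' y Hy) (L2dot_restrC nu E _ _ mE Ly Ly') ReD.
apply: lerD.
  rewrite le_eqVlt; apply/orP; left; apply/eqP.
  have sL : {in s, forall l, L l} by move=> l; rewrite sE => /set_mem [].
  rewrite {1}/L2dot /cintegral/=.
  rewrite (atomic_Rintegral L nu s _ nuE _ us sL).
  - apply: eq_big_seq => l; rewrite sE => /set_mem [_ El].
    rewrite /restr mem_set// (rkhs_hermitian Hk y l) (rkhs_hermitian Hk' y l) conjcK.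
    by rewrite mulrC.
  - apply: measurable_Re_mulJ; last by case: Ly'.
    by apply: cmeasurable_restr => //; case: Ly.
  - move=> l Ll; rewrite sE => /negP lE; rewrite /restr; case: ifPn => [El|_].
      by exfalso; apply: lE; apply/mem_set; split=> //; exact/set_mem.
    by rewrite mul0r.
have mE' := measurableC mE.
have LE := in_L2_restr nu _ _ mE' Ly.
apply: le_trans (Re_le_cmod _) _.
rewrite -(ler_pXn2r (ltn0Sn 1)) ?nnegrE ?cmod_ge0 ?(ltW eta0)//.
apply: le_trans (cauchy_schwarz nu _ _ LE Ly') _.
apply: (@le_trans _ _ ((eta ^+ 2 / (C / A)) * (C / A))); last first.
  by rewrite -mulrA mulVf ?mulr1// gt_eqF.
apply: ler_pM => //; try exact: nsq_ge0.
rewrite -lee_fin -nsqE// /sqint nuE; last 2 first.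
- by move=> z; rewrite lee_fin sqr_ge0.
- by apply/measurable_EFinP/cmeasurable_cmod_sqr; case: LE.
apply: esum_le_seq => t ut tL.
rewrite (_ : \sum_(l <- t) _ = \sum_(l <- [seq l <- t | l \in ~` E]) cmod (k l y) ^+ 2).
  apply: Hrho1; first exact: filter_uniq.
    by move=> l; rewrite mem_filter => /andP[_ /tL].
  move=> l; rewrite mem_filter => /andP[/set_mem + _].
  rewrite /E /setC/= mem_ballE => /negP; rewrite -leNgt => lE.
  by have := metric_triangle x y l; lra.
rewrite big_filter [RHS]big_mkcond; apply: eq_bigr => l _; rewrite /restr.
by case: ifP => // _; rewrite cmod0 expr0n.
Qed.

Lemma integrated_estimate (k' : X -> X -> R[i]) (s : seq X) x r (eta : R) :
  (forall l, H (fun y => k' y l)) -> 0 < r ->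
  (forall y, mdist x y < r ->
    kdiag y <= \sum_(l <- s) complex.Re (k' y l * (k y l)^*)%C + eta) ->
  (\int[mu]_(y in ball x r) (kdiag y)%:E <=
   (\sum_(l <- s) complex.Re (L2dot mu (restr (ball x r) (fun y => k' y l))
     (fun y => k y l)) + eta * vol x r)%:E)%E.
Proof.
move=> Hk' r0 Kle.
have mB : measurable (ball x r) by exact: measurable_mball.
have fB : (mu (ball x r) < +oo)%E by exact: ball_fin.
have iu l : mu.-integrable (ball x r)
    (EFin \o (fun y => complex.Re (k' y l * (k y l)^*)%C)).
  apply: (integrableS measurableT) => //; apply: integrable_Re_mulJ.
    exact: (rkhs_L2 Hk (Hk' l)).
  exact: in_L2_kernel mu H k Hk l.
have [I1 I2] := Rintegral_sum_cst mu (ball x r) _ s _ eta mB fB iu.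
under eq_bigr do rewrite Re_L2dot_restr.
rewrite -I2 /Rintegral fineK; last exact: integrable_fin_num.
apply: le_lower_integral => y.
  by move=> _; rewrite lee_fin (kernel_diag_ge0 mu H k Hk).
by rewrite mem_ballE lee_fin; exact: Kle.
Qed.

(** The points within [rho] of the sphere of radius [r] form [outer].  For a point
    of [inner] the term [T l] is [k' l l <= 1] up to the tail of [k . l], since
    the ball of radius [rho] around it stays inside; for a point of [outer] it
    is at most [M], and there are few such points. *)
Lemma sampling_estimate (e : R) : 0 < e -> exists2 r1 : R, 0 < r1 &
  forall r, r1 <= r -> forall x,
  (\int[mu]_(y in ball x r) (kdiag y)%:E <=
   counting (L `&` ball x r) + (e * vol x r)%:E)%E.
Proof.
move=> e0.
have [nu [k' [nuE Hk' Lnu lA]]] := dual_kernel.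
have [nk' k'le1 nk'mu] := dual_kernel_bounds nu k' nuE Hk' Lnu lA.
have [rho0 [D [rho00 D0 cnt1 cnt2]]] := relative_separation.
have e3 : 0 < e / 3 by rewrite divr_gt0.
have [rho1 rho10 Hrho1] := pointwise_estimate nu k' nuE Hk' Lnu nk' _ e3.
pose eta := e / 3 / (D + 1).
have D1 : 0 < D + 1 by lra.
have eta0 : 0 < eta by rewrite divr_gt0.
have Ai0 : 0 < A^-1 by rewrite invr_gt0.
have eA0 : 0 < eta ^+ 2 * A by rewrite mulr_gt0// exprn_gt0.
have [rho2 rho20 Hrho2] := kernel_tail _ eA0.
pose M := C / A + 1.
have CA0 : 0 < C / A by rewrite divr_gt0.
have M0 : 0 < M by rewrite /M; lra.
pose delta := e / 3 / (M * (D + 1)).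
have MD0 : 0 < M * (D + 1) by rewrite mulr_gt0.
have delta0 : 0 < delta by rewrite divr_gt0.
(* [rho] is an integer because [vol_growth] advances by unit steps; the annulus
   between the radii [r - 2 * rho] and [r + 2 * rho] has width [4 * N]. *)
pose N := (Num.truncn (rho0 + rho1 + rho2)).+1.
have [rho rhoE] : exists rho : R, rho = N%:R by exists N%:R.
have rhoN : rho0 + rho1 + rho2 < rho by rewrite rhoE; exact: truncnS_gt.
have [s0 s00 Hs0] := vol_growth (4 * N) delta delta0.
exists (s0 + 2 * rho) => [|r rs x]; first by lra.
have r0 : 0 < r by lra.
have fin1 := finite_in_ball.
have [s [us sE _]] := counting_finite (R := R) _ (fin1 x (r + rho)).
have [t [ut tE ->]] := counting_finite (R := R) _ (fin1 x r).
have sL : {in s, forall l, L l} by move=> l; rewrite sE => /set_mem [].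
have Hk'l l : H (fun y => k' y l) by exact: (rkhs_kernel Hk').
apply: le_trans (integrated_estimate k' s x r (e / 3) Hk'l r0 _) _.
  by apply: (Hrho1 rho) => //; lra.
rewrite -EFinD lee_fin.
pose V := vol x r.
have V0 : 0 <= V by exact: vol_ge0.
pose T l := complex.Re (L2dot mu (restr (ball x r) (fun y => k' y l)) (fun y => k y l)).
rewrite -/V (_ : \sum_(l <- s) _ = \sum_(l <- s) T l)//.
have mB : measurable (ball x r) by exact: measurable_mball.
have mB' := measurableC mB.
have Lk' l : in_L2 mu (fun y => k' y l) by exact: (rkhs_L2 Hk (Hk'l l)).
have Lk l : in_L2 mu (fun y => k y l) by exact: in_L2_kernel mu H k Hk l.
pose inner := [seq l <- s | mdist x l < r - rho].
pose outer := [seq l <- s | ~~ (mdist x l < r - rho)].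
have sum_split : \sum_(l <- s) T l = \sum_(l <- inner) T l + \sum_(l <- outer) T l.
  by rewrite (bigID (fun l => mdist x l < r - rho))/= !big_filter.
have T_outer l : L l -> T l <= M.
  move=> Ll; apply: le_trans (Re_le_cmod _) _.
  rewrite -(ler_pXn2r (ltn0Sn 1)) ?nnegrE ?cmod_ge0 ?(ltW M0)//.
  apply: le_trans (cauchy_schwarz mu _ _ (in_L2_restr mu _ _ mB (Lk' l)) (Lk l)) _.
  apply: (@le_trans _ _ (A^-1 * C)).
    apply: ler_pM; try exact: nsq_ge0.
      exact: le_trans (nsq_restr_le mu _ _ mB (Lk' l)) (nk'mu l Ll).
    exact: nsq_kernel_le l.
  rewrite mulrC /M; move: CA0; set q := C / A => q0; nra.
have T_inner l : L l -> mdist x l < r - rho -> T l <= 1 + eta.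
  move=> Ll xl.
  have Tl : T l = complex.Re (k' l l) -
      complex.Re (L2dot mu (restr (~` ball x r) (fun y => k' y l)) (fun y => k y l)).
    rewrite (rkhs_reproducing Hk l (Hk'l l)).
    by rewrite (L2dot_restrC mu _ _ _ mB (Lk' l) (Lk l)) ReD addrK.
  rewrite Tl; apply: lerD; first exact: k'le1.
  apply: le_trans (ler_norm _) _; rewrite normrN.
  apply: le_trans (normr_Re_le_cmod _) _.
  rewrite L2dot_restrlr -(ler_pXn2r (ltn0Sn 1)) ?nnegrE ?cmod_ge0 ?(ltW eta0)//.
  apply: le_trans (cauchy_schwarz mu _ _ (Lk' l) (in_L2_restr mu _ _ mB' (Lk l))) _.
  apply: (@le_trans _ _ (A^-1 * (eta ^+ 2 * A))); last first.
    by rewrite mulrCA mulVf ?mulr1// gt_eqF.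
  apply: ler_pM; try exact: nsq_ge0; first exact: nk'mu.
  apply: le_trans (Hrho2 rho _ l); last by lra.
  apply: nsq_restr_sub => //; first by apply: measurableC; exact: measurable_mball.
  by apply: subsetC; apply: subset_mball; lra.
have inner_mem l : l \in inner -> L l /\ mdist x l < r - rho.
  by rewrite mem_filter => /andP[? /sL].
have outer_mem l : l \in outer -> [/\ L l, r - rho <= mdist x l & mdist x l < r + rho].
  rewrite mem_filter -leNgt sE => /andP[h /set_mem[Ll]].
  by rewrite mem_ballE.
have sum_inner : \sum_(l <- inner) T l <= (size inner)%:R * (1 + eta).
  rewrite mulr_natl -sumr_cst_seq big_seq [leRHS]big_seq; apply: ler_sum => l /inner_mem[Ll xl].
  exact: T_inner.
have sum_outer : \sum_(l <- outer) T l <= (size outer)%:R * M.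
  rewrite mulr_natl -sumr_cst_seq big_seq [leRHS]big_seq; apply: ler_sum => l /outer_mem[Ll _ _].
  exact: T_outer.
have inner_t : (size inner)%:R <= (size t)%:R :> R.
  rewrite ler_nat; apply: uniq_leq_size; first exact: filter_uniq.
  move=> l /inner_mem[Ll xl]; rewrite tE; apply/mem_set; split=> //.
  by rewrite mem_ballE; lra.
have inner_V : (size inner)%:R <= D * V.
  apply: cnt1; first exact: filter_uniq.
    by move=> l /inner_mem[].
  by move=> l /inner_mem[_ xl]; lra.
have outer_V : (size outer)%:R <= D * (delta * V).
  apply: (@le_trans _ _ (D * (vol x (r + 2 * rho) - vol x (r - 2 * rho)))).
    apply: cnt2; first by lra.
    - exact: filter_uniq.
    - by move=> l /outer_mem[].
    - by move=> l /outer_mem[_ h1 h2]; split; lra.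
  rewrite ler_wpM2l// lerBlDr.
  have := Hs0 (r - 2 * rho) _ x.
  have -> : r - 2 * rho + (4 * N)%:R = r + 2 * rho by rewrite natrM -rhoE; ring.
  have vm : vol x (r - 2 * rho) <= V by apply: le_vol => //; lra.
  move=> /(_ _)/le_trans; apply; first by lra.
  by rewrite mulrDl mul1r addrC lerD2r ler_wpM2l// ltW.
have h1 : D * V * eta <= e / 3 * V.
  have -> : D * V * eta = (e / 3 * (D / (D + 1))) * V.
    by rewrite /eta; field; rewrite !gt_eqF.
  rewrite ler_wpM2r// ler_piMr ?(ltW e3)// ler_pdivrMr// mul1r; lra.
have h2 : D * (delta * V) * M <= e / 3 * V.
  have -> : D * (delta * V) * M = (e / 3 * (D / (D + 1))) * V.
    by rewrite /delta; field; rewrite !gt_eqF.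
  rewrite ler_wpM2r// ler_piMr ?(ltW e3)// ler_pdivrMr// mul1r; lra.
have h3 : (size inner)%:R * eta <= D * V * eta by rewrite ler_wpM2r// ltW.
have h4 : (size outer)%:R * M <= D * (delta * V) * M by rewrite ler_wpM2r// ltW.
rewrite sum_split; lra.
Qed.

End Sampling.

(** * Interpolating sets *)

Section Interpolation.
Variable L : set X.
Hypothesis interp : is_interpolating H L.

(** The inner product of [g j] and [k . (p j)] is [1] over [X], and has real part
    at least [1 - eta] over the ball of radius [r + rho].  The integrands sum up
    to at most [k y y], which is bounded by [C] on the additional annulus. *)
Lemma interp_count_le (eta : R) : 0 < eta -> exists2 rho : R, 0 < rho &
  forall x r (s : seq X), 0 < r -> uniq s -> {in s, forall l, L l} ->
  {in s, forall l, mdist x l < r} ->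
  (((1 - eta) * (size s)%:R)%:E <= \int[mu]_(y in ball x r) (kdiag y)%:E +
     (C * (vol x (r + rho) - vol x r))%:E)%E.
Proof.
move=> eta0.
have [M HM] := uniform_minimality mu H k Hk L interp.
pose M1 := `|M| + 1.
have M10 : 0 < M1 by rewrite ltr_wpDl.
have e0 : 0 < (eta / M1) ^+ 2 by rewrite exprn_gt0// divr_gt0.
have [rho rho0 Hrho] := kernel_tail _ e0.
exists rho => // x r s r0 us sL sx.
pose p := tnth (in_tuple s).
have ps i : p i \in s by exact: mem_tnth.
have [g [Hg gp gM gK]] : exists g : 'I_(size s) -> X -> R[i], [/\ forall j, H (g j),
     forall j, g j (p j) = 1, forall j, nrm mu (g j) <= M &
     forall y, 0 <= \sum_j complex.Re (g j y * (k y (p j))^*)%C <= complex.Re (k y y)].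
  apply: (dual_basis mu H k Hk _ p M) => j.
  have [g [Hg g1 g0 gM]] := HM (p j) s us (sL _ (ps j)) sL.
  exists g; split=> // i; have [->|ij] := eqVneq i j; first by rewrite g1.
  rewrite g0 ?ps//; apply: contra ij => /eqP.
  by rewrite /p !(tnth_nth x)/= => /eqP; rewrite nth_uniq.
have Lg j : in_L2 mu (g j) by exact: (rkhs_L2 Hk (Hg j)).
have Lk l : in_L2 mu (fun y => k y l) by exact: in_L2_kernel mu H k Hk l.
pose E : set X := ball x (r + rho).
have mE : measurable E by exact: measurable_mball.
have mE' := measurableC mE.
have mB : measurable (ball x r) by exact: measurable_mball.
have BE : ball x r `<=` E by apply: subset_mball; rewrite mdistxx add0r lerDl ltW.
pose u j y := complex.Re (g j y * (k y (p j))^*)%C.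
have iuT j : mu.-integrable [set: X] (EFin \o u j) by exact: integrable_Re_mulJ.
have iu j : mu.-integrable E (EFin \o u j) by exact: (integrableS measurableT).
have fE : (mu E < +oo)%E by apply: ball_fin; rewrite addr_gt0.
have [I1 I2] := Rintegral_sum_cst mu E _ (index_enum 'I_(size s)) u 0 mE fE iu.
have T j : 1 - eta <= \int[mu]_(y in E) u j y.
  rewrite /u -Re_L2dot_restr.
  have /(congr1 (@complex.Re R)) := rkhs_reproducing Hk (p j) (Hg j).
  rewrite gp (L2dot_restrC mu E _ _ mE (Lg j) (Lk _)) ReD.
  suff : complex.Re (L2dot mu (restr (~` E) (g j)) (fun y => k y (p j))) <= eta.
    by move: (complex.Re (L2dot _ _ _)) (complex.Re (L2dot _ _ _)) => a b h /= E1; lra.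
  apply: le_trans (Re_le_cmod _) _; rewrite L2dot_restrlr.
  apply: le_trans (cmod_L2dot_le mu _ _ (Lg j) (in_L2_restr mu _ _ mE' (Lk _))) _.
  apply: (@le_trans _ _ (M1 * (eta / M1))); last by rewrite mulrCA mulfV ?mulr1// gt_eqF.
  apply: ler_pM; try exact: nrm_ge0.
    by apply: le_trans (gM j) _; rewrite /M1 (le_trans (ler_norm _))// lerDl.
  have q0 : 0 <= eta / M1 by rewrite divr_ge0// ltW.
  rewrite -(ler_pXn2r (ltn0Sn 1)) ?nnegrE ?nrm_ge0// nrm_sqr.
  apply: le_trans (Hrho rho (lexx _) (p j)).
  apply: nsq_restr_sub => //; first by apply: measurableC; exact: measurable_mball.
  apply: subsetC; apply: subset_mball.
  by have := sx _ (ps j); lra.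
have S1 : (1 - eta) * (size s)%:R <= \int[mu]_(y in E) (\sum_j u j y + 0).
  rewrite I2 mul0r addr0 -[X in _ * X%:R]card_ord mulr_natr -sumr_const.
  exact: ler_sum.
apply: (@le_trans _ _ ((\int[mu]_(y in E) (\sum_j u j y + 0))%:E)); first by rewrite lee_fin.
rewrite /Rintegral fineK; last exact: integrable_fin_num.
under eq_integral do rewrite addr0.
have mu_ : measurable_fun [set: X] (fun y => \sum_j u j y).
  by apply: measurable_sum => j; case/integrableP: (iuT j) => /measurable_EFinP.
have EE : E = ball x r `|` (E `\` ball x r) by rewrite setDUK.
rewrite {1}EE ge0_integral_setU//; last 4 first.
- exact: measurableD.
- by apply/measurable_EFinP; exact: measurable_funTS.
- by move=> y _; rewrite lee_fin; have /andP[] := gK y.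
- by apply/disj_setPS => y [? []].
apply: leeD.
  apply: le_lower_integral => y _; rewrite lee_fin; have /andP[] := gK y => //.
have -> : ((C * (vol x (r + rho) - vol x r))%:E =
    \int[mu]_(y in E `\` ball x r) (cst C%:E y))%E.
  rewrite integral_cst; last exact: measurableD.
  by rewrite mu_annulus// lerDl ltW.
apply: le_lower_integral => y _; rewrite lee_fin; have /andP[u0 uK] := gK y => //.
exact: le_trans uK (kernel_diag_le y).
Qed.

(** The average of [k y y] is at most [C], so the relative error [eta] of
    [interp_count_le] turns into an absolute one.  The estimate on finite subsets
    also shows that [L] has finitely many points in the ball. *)
Lemma interp_estimate (e : R) : 0 < e -> exists2 r1 : R, 0 < r1 &
  forall r, r1 <= r -> forall x,
  (counting (L `&` ball x r) <=
   \int[mu]_(y in ball x r) (kdiag y)%:E + (e * vol x r)%:E)%E.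
Proof.
move=> e0; have C0 := C_gt0.
have Ce0 : 0 < 2 * (C + e) by lra.
pose eta := e / (2 * (C + e)).
have eta0 : 0 < eta by rewrite divr_gt0.
(* Half of [e] pays for the factor [1 - eta], the other half for the annulus. *)
have etaE : eta * (C + e) = e / 2 by rewrite /eta; field; rewrite gt_eqF//; lra.
have eta1 : 0 < 1 - eta.
  by rewrite subr_gt0 /eta ltr_pdivrMr// mul1r; lra.
pose delta := e / (2 * C).
have delta0 : 0 < delta by rewrite divr_gt0// mulr_gt0.
have deltaE : C * delta = e / 2 by rewrite /delta; field; rewrite gt_eqF.
have [rho rho0 Hrho] := interp_count_le eta eta0.
pose N := (Num.truncn rho).+1.
have rhoN : rho <= N%:R by rewrite ltW// truncnS_gt.
have [s0 s00 Hs0] := vol_growth N delta delta0.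
exists s0 => // r sr x.
have r0 : 0 < r by exact: lt_le_trans sr.
have mB : measurable (ball x r) by exact: measurable_mball.
pose I := fine (\int[mu]_(y in ball x r) (kdiag y)%:E).
pose V := vol x r.
have V0 : 0 <= V by exact: vol_ge0.
have I_ge0 : (0 <= \int[mu]_(y in ball x r) (kdiag y)%:E)%E.
  by apply: integral_ge0 => y _; rewrite lee_fin (kernel_diag_ge0 mu H k Hk).
have I_le : (\int[mu]_(y in ball x r) (kdiag y)%:E <= (C * V)%:E)%E.
  apply: (@le_trans _ _ (\int[mu]_(y in ball x r) (cst C%:E y))%E).
    apply: le_lower_integral => y _; rewrite lee_fin.
      exact: (kernel_diag_ge0 mu H k Hk).
    exact: (kernel_diag_le y).
  by rewrite integral_cst//= volE.
have IE : (\int[mu]_(y in ball x r) (kdiag y)%:E = I%:E)%E.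
  by rewrite fineK// ge0_fin_numE//; apply: le_lt_trans I_le _; rewrite ltry.
have I0 : 0 <= I by rewrite -lee_fin -IE.
have IV : I <= C * V by rewrite -lee_fin -IE.
have bound (s : seq X) : uniq s -> {in s, forall l, (L `&` ball x r) l} ->
    (size s)%:R <= I + e * V.
  move=> us sLB.
  have sL : {in s, forall l, L l} by move=> l ls; have [] := sLB l ls.
  have sx : {in s, forall l, mdist x l < r}.
    by move=> l ls; have [_] := sLB l ls; rewrite mem_ballE.
  have := Hrho x r s r0 us sL sx; rewrite IE -EFinD lee_fin => h.
  have h1 : vol x (r + rho) - V <= delta * V.
    rewrite lerBlDr; apply: (@le_trans _ _ (vol x (r + N%:R))).
      by apply: le_vol => //; rewrite lerD2l.
    by have := Hs0 r sr x; rewrite mulrDl mul1r [X in _ <= X -> _]addrC.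
  have h2 : C * (vol x (r + rho) - V) <= C * (delta * V) by rewrite ler_pM2l.
  rewrite -(ler_pM2l eta1); apply: le_trans h _.
  have h3 : C * (delta * V) = e / 2 * V by rewrite mulrA deltaE.
  have h4 : eta * (I + e * V) <= e / 2 * V.
    rewrite -etaE -mulrA ler_pM2l// mulrDl lerD2r//.
  by move: h2 h4; rewrite h3 -/V; lra.
have fin := finite_set_bounded _ _ bound.
have [t [ut tE ->]] := counting_finite (R := R) _ fin.
rewrite IE -EFinD lee_fin; apply: bound => // l.
by rewrite tE => /set_mem.
Qed.

End Interpolation.

End Density.

(** * Passage to the limit *)

Lemma le_ereal_inf_range {R : realType} {T : Type} (a b : T -> \bar R) (e : R) :
  (forall x, a x <= b x + e%:E)%E ->
  (ereal_inf (range a) <= ereal_inf (range b) + e%:E)%E.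
Proof.
move=> ab; rewrite -leeBlDr//; apply: le_ereal_inf_tmp => _ [x _ <-].
by rewrite leeBlDr//; apply: le_trans (ab x); apply: ereal_inf_lbound; exists x.
Qed.

Lemma le_ereal_sup_range {R : realType} {T : Type} (a b : T -> \bar R) (e : R) :
  (forall x, a x <= b x + e%:E)%E ->
  (ereal_sup (range a) <= ereal_sup (range b) + e%:E)%E.
Proof.
move=> ab; apply: ge_ereal_sup => _ [x _ <-]; apply: le_trans (ab x) _.
by rewrite leeD2r//; apply: ereal_sup_ubound; exists x.
Qed.

Section Limits.
Context {R : realType} {T : Type}.
Variables (f g : R -> T -> \bar R).
Hypothesis fg : forall e : R, 0 < e -> exists2 r1 : R, 0 < r1 &
  forall r, r1 <= r -> forall x, (f r x <= g r x + e%:E)%E.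

Let near_ge (r1 : R) (V : set R) : (+oo%R : set_system R) V ->
  (+oo%R : set_system R) (V `&` [set r | r1 <= r]).
Proof. by move=> FV; apply: filterI => //; exact: (nbhs_pinfty_ge (num_real r1)). Qed.

Lemma le_limf_einf_inf :
  (limf_einf (fun r => ereal_inf (range (f r))) +oo%R <=
   limf_einf (fun r => ereal_inf (range (g r))) +oo%R)%E.
Proof.
apply/lee_addgt0Pr => e e0; have [r1 _ H1] := fg e e0.
rewrite !limf_einfE; apply: ge_ereal_sup => _ [V FV <-].
rewrite -leeBlDr//.
apply: (@le_trans _ _ (ereal_inf ((fun r => ereal_inf (range (g r))) @`
   (V `&` [set r | r1 <= r])))); last first.
  by apply: ereal_sup_ubound; exists (V `&` [set r | r1 <= r]) => //; exact: near_ge.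
apply: le_ereal_inf_tmp => _ [r [Vr /= r1r] <-]; rewrite EFinN leeBlDr//.
apply: le_trans (le_ereal_inf_range _ _ e (H1 r r1r)).
by apply: ereal_inf_lbound; exists r.
Qed.

Lemma le_limf_esup_sup :
  (limf_esup (fun r => ereal_sup (range (f r))) +oo%R <=
   limf_esup (fun r => ereal_sup (range (g r))) +oo%R)%E.
Proof.
apply/lee_addgt0Pr => e e0; have [r1 _ H1] := fg e e0.
rewrite !limf_esupE -leeBlDr//; apply: le_ereal_inf_tmp => _ [V FV <-].
rewrite leeBlDr//.
apply: (@le_trans _ _ (ereal_sup ((fun r => ereal_sup (range (f r))) @`
   (V `&` [set r | r1 <= r])))).
  by apply: ereal_inf_lbound; exists (V `&` [set r | r1 <= r]) => //; exact: near_ge.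
apply: ge_ereal_sup => _ [r [Vr /= r1r] <-].
apply: (le_trans (le_ereal_sup_range _ _ e (H1 r r1r))).
by rewrite leeD2r//; apply: ereal_sup_ubound; exists r.
Qed.

End Limits.

Lemma sampling_bounds {R : realType} {d : measure_display}
  {X : metricMeasurableType R d} (mu : {measure set X -> \bar R})
  (H : set (X -> R[i])) (k : X -> X -> R[i]) (L : set X) :
  is_rkhs mu H k -> is_sampling mu H L -> exists A B : R, [/\ 0 < A, 0 < B,
    forall f, H f -> ((A * nsq mu f)%:E <= sqsum L f)%E &
    forall f, H f -> (sqsum L f <= (B * nsq mu f)%:E)%E].
Proof.
move=> Hk [A [B [A0 B0 AB]]]; exists A, B; split=> // f Hf;
  rewrite EFinM -nsqE -?L2norm_sqr; try exact: (rkhs_L2 Hk Hf);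
  by have [] := AB f Hf.
Qed.

Local Open Scope ereal_scope.

Theorem theorem1p1 (R : realType) (d : measure_display)
  (X : metricMeasurableType R d) (mu : {measure set X -> \bar R})
  (mdist_meas : measurable_fun [set: X * X]
     (fun p : X * X => mdist p.1 p.2 : R))
  (ball_fin : forall (x : X) (r : R), (0 < r)%R -> mu (ball x r) < +oo)
  (ball_lower : exists2 r : R, (0 < r)%R &
     0 < ereal_inf (range (fun x : X => mu (ball x r))))
  (annular_decay :
     ereal_sup (range (fun x : X =>
       mu (ball x r `\` ball x (r - 1)%R) / mu (ball x r)))
       @[r --> +oo%R] --> (0 : \bar R))
  (H : set (X -> R[i])) (k : X -> X -> R[i]) (Hk : is_rkhs mu H k)
  (diag_lower : 0 < ereal_inf (range (fun x : X => (complex.Re (k x x))%:E)))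
  (C sigma : R) (C_gt0 : (0 < C)%R) (sigma_gt0 : (0 < sigma)%R)
  (off_diag : forall x y : X,
     (cmod (k x y) <= C * (1 + mdist x y) `^ (- sigma))%R)
  (tail_decay :
     ereal_sup (range (fun x : X =>
       \int[mu]_(y in ~` ball x r)
         ((1 + mdist x y) `^ (- (2 * sigma)))%R%:E))
       @[r --> +oo%R] --> (0 : \bar R)) :
  (forall L : set X, is_sampling mu H L ->
     limf_einf (fun r : R =>
       ereal_inf (range (fun x : X => ball_average mu k x r))) +oo%R
     <= lower_density mu L) /\
  (forall L : set X, is_interpolating H L ->
     upper_density mu L
     <= limf_esup (fun r : R =>
       ereal_sup (range (fun x : X => ball_average mu k x r))) +oo%R).

Proof.
have vol_gt0 := vol_gt0_eventually mu mdist_meas ball_fin ball_lower.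
have [c c0 diag_ge] : exists2 c : R, (0 < c)%R &
    forall x, (c <= complex.Re (k x x))%R.
  have lb x : ereal_inf (range (fun x => (complex.Re (k x x))%:E)) <=
      (complex.Re (k x x))%:E by apply: ereal_inf_lbound; exists x.
  move: diag_lower lb; case: (ereal_inf _) => [c| |]// c0 lb.
  - by exists c => // x; rewrite -lee_fin.
  - by exists 1%R => // x; have := lb x; rewrite leye_eq.
have [r0 r0_gt0 Hr0] := vol_gt0.
have Vinv x r : (r0 <= r)%R -> (mu (ball x r))^-1 = ((vol mu x r)^-1)%:E.
  by move=> rr; rewrite (volE mu ball_fin) inver gt_eqF// Hr0.
(* Dividing an estimate by the volume of the ball; [counting] and the integral
   both occur as [b]. *)
have scale (e : R) x r (a b : \bar R) : (0 < e)%R -> (r0 <= r)%R -> 0 <= b ->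
    a <= b + (e * vol mu x r)%:E ->
    (mu (ball x r))^-1 * a <= b / mu (ball x r) + e%:E.
  move=> e0 rr b0 ab; rewrite Vinv//; have V0 := Hr0 r rr x.
  apply: le_trans (lee_wpmul2l _ ab) _; first by rewrite lee_fin invr_ge0 ltW.
  rewrite ge0_muleDr//; last by rewrite lee_fin mulr_ge0// ltW.
  by rewrite muleC leeD2l// -EFinM mulrCA mulVf ?mulr1// gt_eqF.
split=> L HL.
- have [A [B [A0 B0 lowA upB]]] := sampling_bounds mu H k L Hk HL.
  apply: le_limf_einf_inf => e e0.
  have [r1 r10 H1] := sampling_estimate mu mdist_meas ball_fin annular_decay vol_gt0
    H k Hk C sigma C_gt0 sigma_gt0 off_diag c c0 diag_ge tail_decay L A B A0 B0
    lowA upB e e0.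
  exists (r0 + r1)%R => [|r rr x]; first exact: addr_gt0.
  apply: scale => //; first by apply: le_trans rr; rewrite lerDl ltW.
  apply: H1; apply: le_trans rr; rewrite lerDr ltW//.
- apply: le_limf_esup_sup => e e0.
  have [r1 r10 H1] := interp_estimate mu mdist_meas ball_fin annular_decay vol_gt0
    H k Hk C sigma C_gt0 off_diag tail_decay L HL e e0.
  exists (r0 + r1)%R => [|r rr x]; first exact: addr_gt0.
  rewrite muleC /ball_average [X in X + _]muleC; apply: scale => //.
  + by apply: le_trans rr; rewrite lerDl ltW.
  + by apply: integral_ge0 => y _; rewrite lee_fin (kernel_diag_ge0 mu H k Hk).
  + by apply: H1; apply: le_trans rr; rewrite lerDr ltW.
Qed.
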